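(* Let $j\in C^2(\mathbb{R}^3)^3$ be such that $j\neq 0$ everywhere in $\mathbb{R}^3$ and $\operatorname{div} j=0$ in $\mathbb{R}^3$. Then $j$ is locally isotropically realizable in $\mathbb{R}^3$ with some positive $C^1$ conductivity $\sigma$ if and only if $$j\cdot\operatorname{curl} j=0\quad\text{in }\mathbb{R}^3.$$
   Context: The field $j$ is locally isotropically realizable in $\mathbb{R}^3$ with a positive $C^1$ conductivity if every point of $\mathbb{R}^3$ has an open neighborhood $V$ on which there exist a positive function $\sigma\in C^1(V)$ and a function $u\in C^1(V)$ with $j=\sigma\nabla u$ in $V$. *)

(* Defs.v *)
From Stdlib Require Import Reals.
From Coquelicot Require Import Coquelicot.
Open Scope R_scope.

(* A point ((x1, x2), x3).  Coquelicot equips this product with the sup-norm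
   uniform structure, which induces the usual topology of R^3. *)
Notation R3 := (R * R * R)%type.

Inductive axis : Set := ax1 | ax2 | ax3.

Definition coord (i : axis) (p : R3) : R :=
  match i with
  | ax1 => fst (fst p)
  | ax2 => snd (fst p)
  | ax3 => snd p
  end.

Definition set_coord (i : axis) (p : R3) (t : R) : R3 :=
  match i with
  | ax1 => (t, snd (fst p), snd p)
  | ax2 => (fst (fst p), t, snd p)
  | ax3 => (fst (fst p), snd (fst p), t)
  end.

Definition ex_partial (i : axis) (f : R3 -> R) (p : R3) : Prop :=
  ex_derive (fun t : R => f (set_coord i p t)) (coord i p).

Definition partial (i : axis) (f : R3 -> R) (p : R3) : R :=
  Derive (fun t : R => f (set_coord i p t)) (coord i p).

(* f is of class C^n on V.  This is meant for open V only: then the partial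
   derivatives at points of V, hence the whole predicate, do not depend on the
   values of the total function f outside V. *)
Fixpoint Ck (n : nat) (V : R3 -> Prop) (f : R3 -> R) : Prop :=
  (forall p, V p -> continuous f p) /\
  match n with
  | O => True
  | S m => forall i, (forall p, V p -> ex_partial i f p) /\ Ck m V (partial i f)
  end.

Definition Ck_field (n : nat) (V : R3 -> Prop) (j : R3 -> R3) : Prop :=
  forall i, Ck n V (fun p => coord i (j p)).

Definition whole_space : R3 -> Prop := fun _ => True.

Definition grad (u : R3 -> R) (p : R3) : R3 :=
  (partial ax1 u p, partial ax2 u p, partial ax3 u p).

Definition div (j : R3 -> R3) (p : R3) : R :=
  partial ax1 (fun q => coord ax1 (j q)) p +
  partial ax2 (fun q => coord ax2 (j q)) p +
  partial ax3 (fun q => coord ax3 (j q)) p.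

Definition curl (j : R3 -> R3) (p : R3) : R3 :=
  let d i k := partial i (fun q => coord k (j q)) p in
  (d ax2 ax3 - d ax3 ax2, d ax3 ax1 - d ax1 ax3, d ax1 ax2 - d ax2 ax1).

Definition dot (a b : R3) : R :=
  coord ax1 a * coord ax1 b + coord ax2 a * coord ax2 b +
  coord ax3 a * coord ax3 b.

Definition locally_isotropically_realizable (j : R3 -> R3) : Prop :=
  forall x : R3, exists V : R3 -> Prop,
    open V /\ V x /\
    exists (sigma u : R3 -> R),
      (forall p, V p -> 0 < sigma p) /\ Ck 1 V sigma /\ Ck 1 V u /\
      (forall p, V p -> j p = scal (sigma p) (grad u p)).

(* Main.v *)
Require Import Defs.
From Stdlib Require Import Reals Lra Lia Classical ClassicalEpsilon FunctionalExtensionality.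
From Coquelicot Require Import Coquelicot.
Open Scope R_scope.

(** If [j = sigma grad u] then [u] is in fact of class C^2, so that
    [curl j = grad sigma x grad u] is orthogonal to [j].

    Conversely (Frobenius), rotate the coordinates so that [j_3 <> 0] near [x0] and
    put [A = - j_1 / j_3], [B = - j_2 / j_3]; then [j . curl j = 0] says that the plane
    field [dz = A dx + B dy] is integrable. From [p = (x, y, z)] follow the leaf above
    the segment from [(x, y)] to [(x0, y0)], i.e. solve the scalar ODE
    [W' = - ((x - x0) A + (y - y0) B)] with [W(0) = z], and let [u p = W(1)]. The
    derivatives of [u] solve linear ODEs; comparing them gives [u_x = - A u_z] and
    [u_y = - B u_z], while [u_z] is the exponential of an integral, hence positive and
    C^1. Thus [sigma = j_3 / u_z], up to sign. *)

(** * Continuity and differentiation of integrals *)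

(** [W(1)] is the height at which the leaf through [p] crosses the vertical line above [(x0, y0)],
    hence a label of that leaf. Following a segment replaces two successive flows, one in x and one
    in y, by a single scalar ODE; in return [p] enters its right-hand side as well as its initial
    value. The delicate point is regularity: [u_z] divides [j_3] in [sigma], so it has to be C^1
    itself, which the C^1 regularity of [u] does not give. It is the exponential of an integral of
    the z-derivatives of [A] and [B] along the flow. These are C^1 because [A] and [B] are C^2, so
    one differentiation under the integral suffices and no second derivative of the flow is ever
    taken. Differentiability in the parameters rests on Hadamard's lemma: the increment of a flow
    solves a linear ODE exactly, and the explicit solution of that ODE is continuous in the
    parameters, so no remainder is estimated. To have continuity in time and parameters at once, the
    nonlinear ODE is solved as one fixed-point problem for functions of both. *)

Lemma continuous_pair {T U V : UniformSpace} (f : T -> U) (g : T -> V) (x : T) :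
  continuous f x -> continuous g x ->
  continuous (fun t => (f t, g t) : U * V) x.
Proof.
  intros Hf Hg.
  apply (continuous_comp_2 f g (fun u v => (u, v))); auto.
  apply (continuous_ext (fun z => z)); [now intros [u v]|apply continuous_id].
Qed.

Lemma continuous_fst_comp {T U V : UniformSpace} (f : T -> U * V) (x : T) :
  continuous f x -> continuous (fun t => fst (f t)) x.
Proof.
  intros Hf. apply (continuous_comp f fst); auto.
  destruct (f x); apply continuous_fst.
Qed.

Lemma continuous_snd_comp {T U V : UniformSpace} (f : T -> U * V) (x : T) :
  continuous f x -> continuous (fun t => snd (f t)) x.
Proof.
  intros Hf. apply (continuous_comp f snd); auto.
  destruct (f x); apply continuous_snd.
Qed.

Lemma continuous_Rplus {T : UniformSpace} (f g : T -> R) (x : T) :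
  continuous f x -> continuous g x -> continuous (fun t => f t + g t) x.
Proof. exact (continuous_plus (V := R_NormedModule) f g x). Qed.

Lemma continuous_Rminus {T : UniformSpace} (f g : T -> R) (x : T) :
  continuous f x -> continuous g x -> continuous (fun t => f t - g t) x.
Proof. exact (continuous_minus (V := R_NormedModule) f g x). Qed.

Lemma continuous_Ropp {T : UniformSpace} (f : T -> R) (x : T) :
  continuous f x -> continuous (fun t => - f t) x.
Proof. exact (continuous_opp (V := R_NormedModule) f x). Qed.

Lemma continuous_Rmult {T : UniformSpace} (f g : T -> R) (x : T) :
  continuous f x -> continuous g x -> continuous (fun t => f t * g t) x.
Proof. exact (continuous_mult (K := R_AbsRing) f g x). Qed.

Lemma continuous_Rinv_fun {T : UniformSpace} (f : T -> R) (x : T) :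
  continuous f x -> f x <> 0 -> continuous (fun t => / f t) x.
Proof. intros Hf H0. apply (continuous_comp f Rinv); auto. now apply continuous_Rinv. Qed.

Lemma continuous_Rexp {T : UniformSpace} (f : T -> R) (x : T) :
  continuous f x -> continuous (fun t => exp (f t)) x.
Proof. intros Hf. apply (continuous_comp f exp); auto. apply continuous_exp. Qed.

(* Coquelicot's lemmas leave equations whose type is only convertible to [R]. *)
Ltac Rring :=
  match goal with |- @eq _ ?x ?y => change (@eq R x y) end; ring.

(** Recursion on the head operation. Subterms it does not recognise are closed by [assumption] or
    left as goals, so callers put the continuity of the atoms into the context beforehand. *)
Ltac cont :=
  lazymatch goal with
  | |- continuous (fun _ => ?c) _ => apply continuous_const
  | |- continuous (fun t => t) _ => apply continuous_id
  | |- continuous fst _ => apply (continuous_fst_comp (fun z => z)); apply continuous_id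
  | |- continuous snd _ => apply (continuous_snd_comp (fun z => z)); apply continuous_id
  | |- continuous (fun t => (@?f t, @?g t)) _ => apply (continuous_pair f g); cont
  | |- continuous (fun t => fst (@?f t)) _ => apply (continuous_fst_comp f); cont
  | |- continuous (fun t => snd (@?f t)) _ => apply (continuous_snd_comp f); cont
  | |- continuous (fun t => @?f t + @?g t) _ => apply (continuous_Rplus f g); cont
  | |- continuous (fun t => @?f t - @?g t) _ => apply (continuous_Rminus f g); cont
  | |- continuous (fun t => @?f t * @?g t) _ => apply (continuous_Rmult f g); cont
  | |- continuous (fun t => - @?f t) _ => apply (continuous_Ropp f); cont
  | |- continuous (fun t => exp (@?f t)) _ => apply (continuous_Rexp f); cont
  | |- _ => try assumption
  end.

Lemma is_derive_Rconst (c t : R) : is_derive (fun _ => c) t 0.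
Proof. exact (is_derive_const (K := R_AbsRing) (V := R_NormedModule) c t). Qed.

Lemma is_derive_Rid (t : R) : is_derive (fun s => s) t 1.
Proof. exact (is_derive_id (K := R_AbsRing) t). Qed.

Lemma is_derive_Rplus (f g : R -> R) (t df dg : R) :
  is_derive f t df -> is_derive g t dg -> is_derive (fun s => f s + g s) t (df + dg).
Proof. exact (is_derive_plus (K := R_AbsRing) (V := R_NormedModule) f g t df dg). Qed.

Lemma is_derive_Rminus (f g : R -> R) (t df dg : R) :
  is_derive f t df -> is_derive g t dg -> is_derive (fun s => f s - g s) t (df - dg).
Proof. exact (is_derive_minus (K := R_AbsRing) (V := R_NormedModule) f g t df dg). Qed.

Lemma is_derive_Ropp (f : R -> R) (t df : R) :
  is_derive f t df -> is_derive (fun s => - f s) t (- df).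
Proof. exact (is_derive_opp (K := R_AbsRing) (V := R_NormedModule) f t df). Qed.

Lemma is_derive_Rmult (f g : R -> R) (t df dg : R) :
  is_derive f t df -> is_derive g t dg ->
  is_derive (fun s => f s * g s) t (df * g t + f t * dg).
Proof. intros Hf Hg. exact (is_derive_mult f g t df dg Hf Hg Rmult_comm). Qed.

Lemma is_derive_Rexp (f : R -> R) (t df : R) :
  is_derive f t df -> is_derive (fun s => exp (f s)) t (df * exp (f t)).
Proof. intros Hf. exact (is_derive_comp exp f t _ _ (is_derive_exp (f t)) Hf). Qed.

Lemma is_derive_eq (f : R -> R) (t l l' : R) :
  is_derive f t l -> l = l' -> is_derive f t l'.
Proof. now intros H <-. Qed.

Lemma is_derive_continuous (f : R -> R) (t l : R) : is_derive f t l -> continuous f t.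
Proof. intros H. apply (ex_derive_continuous f). now exists l. Qed.

Lemma continuous_section {T : UniformSpace} (k : R -> T -> R) (s : R) (p : T) :
  continuous (fun q : R * T => k (fst q) (snd q)) (s, p) ->
  continuous (fun u => k u p) s.
Proof.
  intros H.
  apply (continuous_comp (fun u : R => (u, p)) (fun q => k (fst q) (snd q))); auto.
  cont.
Qed.

Lemma locally_Rabs (x : R) (P : R -> Prop) :
  locally x P <-> exists d : posreal, forall y, Rabs (y - x) < d -> P y.
Proof. split; intros [d H]; exists d; exact H. Qed.

Lemma continuous_Rabs_lt {T : UniformSpace} (f : T -> R) (x : T) :
  continuous f x <->
  forall eps : posreal, locally x (fun y => Rabs (f y - f x) < eps).
Proof.
  split; intros H.
  - intros eps. apply (H (fun z => Rabs (z - f x) < eps)). now exists eps.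
  - intros P [eps HP]. unfold filtermap. generalize (H eps). apply filter_imp.
    intros y Hy. apply HP, Hy.
Qed.

(* Compactness of [[0, 1]] makes the continuity uniform in the integration variable. *)
Lemma uniform_continuity_param {T : UniformSpace} (k : R -> T -> R) (p0 : T) :
  (forall s, 0 <= s <= 1 ->
     continuous (fun q : R * T => k (fst q) (snd q)) (s, p0)) ->
  forall eps : posreal, locally p0 (fun p =>
    forall s, 0 <= s <= 1 -> Rabs (k s p - k s p0) < eps).
Proof.
  intros Hk eps.
  assert (He : 0 < eps / 2) by (destruct eps; simpl; lra).
  (* The compactness lemma takes a gauge defined on the whole line; outside [[0, 1]] any radius will
     do. *)
  assert (Hd : forall s, exists d : posreal, 0 <= s <= 1 ->
     forall s' p, Rabs (s' - s) < d -> ball p0 d p ->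
       Rabs (k s' p - k s p0) < eps / 2).
  { intros s. destruct (classic (0 <= s <= 1)) as [Hs|Hs].
    - destruct (proj1 (continuous_Rabs_lt _ _) (Hk s Hs) (mkposreal _ He))
        as [d Hd].
      exists d. intros _ s' p H1 H2. apply (Hd (s', p)). split; assumption.
    - exists eps. tauto. }
  set (delta := fun s => proj1_sig (constructive_indefinite_description _ (Hd s))).
  destruct (compactness_value_1d 0 1 delta) as [d Hcomp].
  (* Compactness provides the centre [t] of a small interval around [s] only under a double
     negation, so the goal is proved by contradiction. *)
  exists d. intros p Hp s Hs. apply NNPP. intros Hn.
  apply (Hcomp s Hs). intros (t & Ht & Hst & Hdt).
  apply Hn. unfold delta in Hst, Hdt.
  destruct (constructive_indefinite_description _ (Hd t)) as [dt H]; simpl in *.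
  specialize (H Ht).
  assert (H1 := H s p Hst (ball_le _ _ _ Hdt _ Hp)).
  assert (H2 := H s p0 Hst (ball_center _ _)).
  replace (k s p - k s p0) with ((k s p - k t p0) - (k s p0 - k t p0)) by ring.
  eapply Rle_lt_trans; [apply Rabs_triang|]. rewrite Rabs_Ropp. lra.
Qed.

(** The convergence uses joint continuity over [p0] alone; the second hypothesis makes the
    neighbouring integrals exist. *)
Lemma continuous_RInt_param {T : UniformSpace} (k : R -> T -> R) (p0 : T) :
  (forall s, 0 <= s <= 1 ->
     continuous (fun q : R * T => k (fst q) (snd q)) (s, p0)) ->
  locally p0 (fun p => forall s, 0 <= s <= 1 -> continuous (fun u => k u p) s) ->
  continuous (fun p => RInt (fun s => k s p) 0 1) p0.
Proof.
  intros H0 Hk.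
  assert (Hint : forall p, (forall s, 0 <= s <= 1 -> continuous (fun u => k u p) s) ->
     ex_RInt (fun s => k s p) 0 1).
  { intros p Hp. apply (ex_RInt_continuous (V := R_CompleteNormedModule)).
    now rewrite Rmin_left, Rmax_right by lra. }
  assert (Hp0 := locally_singleton _ _ Hk).
  apply continuous_Rabs_lt. intros eps.
  assert (He : 0 < eps / 2) by (destruct eps; simpl; lra).
  generalize (filter_and _ _ Hk (uniform_continuity_param k p0 H0 (mkposreal _ He))).
  apply filter_imp. intros p [Hp Hu].
  rewrite <- (RInt_minus (V := R_CompleteNormedModule)) by auto.
  eapply Rle_lt_trans.
  - apply abs_RInt_le_const with (M := eps / 2); [lra| |].
    + apply (ex_RInt_minus (V := R_NormedModule)); auto.
    + intros t Ht. left. apply Hu, Ht.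
  - destruct eps; simpl in *; lra.
Qed.

(** Moves a variable end point into the integrand, where it becomes one more parameter of an
    integral over [[0, 1]]. *)
Lemma RInt_rescale (f : R -> R) (t : R) :
  ex_RInt f 0 t -> RInt f 0 t = t * RInt (fun th => f (t * th)) 0 1.
Proof.
  intros Hf.
  destruct (Req_dec t 0) as [->|Ht].
  - rewrite RInt_point. unfold zero; simpl; ring.
  - assert (Hf' : ex_RInt f (t * 0 + 0) (t * 1 + 0)).
    { now replace (t * 0 + 0) with 0 by ring; replace (t * 1 + 0) with t by ring. }
    assert (H := RInt_comp_lin f t 0 0 1 Hf').
    replace (t * 0 + 0) with 0 in H by ring; replace (t * 1 + 0) with t in H by ring.
    rewrite <- H.
    rewrite (RInt_ext _ (fun y => scal t (f (t * y)))).
    2:{ intros x _. now rewrite Rplus_0_r. }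
    apply (RInt_scal (V := R_CompleteNormedModule)).
    assert (He := ex_RInt_comp_lin f t 0 0 1 Hf').
    apply (ex_RInt_scal _ _ _ (/ t)) in He.
    revert He. apply ex_RInt_ext. intros x _.
    rewrite Rplus_0_r. unfold scal; simpl; unfold mult; simpl. now field.
Qed.

Lemma scaled_lt (t th T : R) : 0 <= th <= 1 -> Rabs t < T -> Rabs (t * th) < T.
Proof.
  intros H1 H2. rewrite Rabs_mult, (Rabs_pos_eq th) by lra.
  assert (0 <= Rabs t) by apply Rabs_pos. nra.
Qed.

Lemma between_Rabs_lt (t s T : R) :
  Rabs t < T -> Rmin 0 t <= s <= Rmax 0 t -> Rabs s < T.
Proof.
  intros Ht. unfold Rmin, Rmax; destruct (Rle_dec 0 t); intros Hs;
  unfold Rabs in *; repeat destruct Rcase_abs; lra.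
Qed.

Lemma ex_RInt_from_0 (f : R -> R) (T t : R) :
  (forall s, Rabs s < T -> continuous f s) -> Rabs t < T -> ex_RInt f 0 t.
Proof.
  intros Hf Ht. apply (ex_RInt_continuous (V := R_CompleteNormedModule)).
  intros s Hs. apply Hf. now apply between_Rabs_lt with t.
Qed.

Lemma locally_Rabs_lt (T t : R) : Rabs t < T -> locally t (fun s => Rabs s < T).
Proof.
  intros Ht. assert (H : 0 < T - Rabs t) by lra.
  exists (mkposreal _ H). intros s Hs.
  unfold ball in Hs; simpl in Hs; unfold AbsRing_ball, abs, minus, plus, opp in Hs;
  simpl in Hs.
  replace s with (t + (s + - t)) by ring.
  eapply Rle_lt_trans; [apply Rabs_triang|lra].
Qed.

Lemma is_derive_RInt_from_0 (f : R -> R) (T t : R) :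
  (forall s, Rabs s < T -> continuous f s) -> Rabs t < T ->
  is_derive (fun t => RInt f 0 t) t (f t).
Proof.
  intros Hf Ht. apply (is_derive_RInt f _ 0); [|now apply Hf].
  generalize (locally_Rabs_lt _ _ Ht). apply filter_imp. intros s Hs.
  apply (RInt_correct (V := R_CompleteNormedModule)).
  now apply ex_RInt_from_0 with T.
Qed.

(** After rescaling to [[0, 1]], the pair (end point, parameter) is the parameter of
    [continuous_RInt_param]. *)
Lemma continuous_RInt_param_from_0 {T : UniformSpace} (f : R -> T -> R)
  (D : T -> Prop) (tau t : R) (p : T) :
  open D ->
  (forall s q, Rabs s < tau -> D q ->
     continuous (fun z : R * T => f (fst z) (snd z)) (s, q)) ->
  Rabs t < tau -> D p ->
  continuous (fun z : R * T => RInt (fun s => f s (snd z)) 0 (fst z)) (t, p).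
Proof.
  intros HD Hf Ht Hp.
  assert (Hloc : locally (t, p) (fun z : R * T => Rabs (fst z) < tau /\ D (snd z))).
  { apply filter_and.
    - apply (continuous_fst t p (fun s => Rabs s < tau)). now apply locally_Rabs_lt.
    - apply (continuous_snd t p D). now apply HD. }
  apply (continuous_ext_loc _
    (fun z : R * T => fst z * RInt (fun th => f (fst z * th) (snd z)) 0 1)).
  - revert Hloc. apply filter_imp. intros [s q] [Hs Hq]; simpl in *.
    symmetry. apply (RInt_rescale (fun s => f s q)). apply ex_RInt_from_0 with tau; auto.
    intros s' Hs'. apply (continuous_section f). auto.
  - apply continuous_Rmult; [cont|].
    apply (continuous_RInt_param (fun th (z : R * T) => f (fst z * th) (snd z))).
    + intros th Hth.
      apply (continuous_comp (fun z : R * (R * T) => (fst (snd z) * fst z, snd (snd z)))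
        (fun z : R * T => f (fst z) (snd z))); [cont|simpl].
      apply Hf; auto. now apply scaled_lt.
    + revert Hloc. apply filter_imp. intros [s q] [Hs Hq] th Hth; simpl in *.
      apply (continuous_comp (fun u => s * u) (fun u => f u q)); [cont|].
      apply (continuous_section f). apply Hf; auto. now apply scaled_lt.
Qed.

(** * Slopes, Hadamard's lemma and the chain rule *)

Lemma is_derive_of_slope (F Q : R -> R) (t : R) :
  locally t (fun s => F s - F t = (s - t) * Q s) -> continuous Q t ->
  is_derive F t (Q t).
Proof.
  intros HF HQ. apply is_derive_Reals. intros eps Heps.
  destruct (proj1 (locally_Rabs _ _)
    (filter_and _ _ HF (proj1 (continuous_Rabs_lt _ _) HQ (mkposreal _ Heps))))
    as [d Hd].
  exists d. intros h Hh Hhd.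
  destruct (Hd (t + h)) as [H1 H2]; [now replace (t + h - t) with h by ring|].
  rewrite H1. simpl in H2. replace ((t + h - t) * Q (t + h) / h) with (Q (t + h)) by now field.
  exact H2.
Qed.

(** With [is_derive_of_slope], this is Carathéodory's form of differentiability: a derivative is the
    value at [t] of a slope function continuous there. *)
Lemma ex_slope (a : R -> R) (t da : R) :
  is_derive a t da ->
  exists q, continuous q t /\ q t = da /\ forall s, a s - a t = (s - t) * q s.
Proof.
  intros Ha. apply is_derive_Reals in Ha.
  exists (fun s => if Req_EM_T s t then da else (a s - a t) / (s - t)).
  split; [|split].
  - apply continuous_Rabs_lt. intros eps.
    destruct (Ha eps (cond_pos eps)) as [d Hd].
    apply locally_Rabs. exists d. intros s Hs.
    destruct (Req_EM_T t t) as [_|[]]; [|reflexivity].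
    destruct (Req_EM_T s t) as [_|Hst].
    + rewrite Rminus_diag, Rabs_R0. apply cond_pos.
    + specialize (Hd (s - t)). replace (t + (s - t)) with s in Hd by ring.
      apply Hd; [lra|assumption].
  - now destruct (Req_EM_T t t).
  - intros s. destruct (Req_EM_T s t) as [->|Hst]; [ring|field; lra].
Qed.

(** Since [a] vanishes at [t], the slope of the product is the slope of [a] times [H], and
    continuity of [H] replaces its differentiability. *)
Lemma is_derive_mult_vanish (a H : R -> R) (t da : R) :
  is_derive a t da -> a t = 0 -> continuous H t ->
  is_derive (fun s => a s * H s) t (da * H t).
Proof.
  intros Ha H0 HH. destruct (ex_slope _ _ _ Ha) as (q & Hq & <- & Hs).
  apply (is_derive_of_slope _ (fun s => q s * H s)).
  - apply filter_forall. intros s. specialize (Hs s). rewrite H0 in *.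
    rewrite Rminus_0_r in Hs. rewrite Hs. ring.
  - now apply continuous_Rmult.
Qed.

(** Hadamard's quotient: for [g] the derivative of [f] it equals [(f b - f a) / (b - a)], but as an
    integral it also makes sense at [a = b] and depends continuously on both ends. *)
Definition mean_on_segment (g : R -> R) (a b : R) : R :=
  RInt (fun th => g (a + th * (b - a))) 0 1.

Lemma mean_on_segment_refl (g : R -> R) (a : R) : mean_on_segment g a a = g a.
Proof.
  unfold mean_on_segment. rewrite (RInt_ext _ (fun _ => g a)).
  - rewrite RInt_const. unfold scal; simpl; unfold mult; simpl; ring.
  - intros th _. f_equal. ring.
Qed.

Lemma segment_in_ball (c r a b th : R) :
  Rabs (a - c) < r -> Rabs (b - c) < r -> 0 <= th <= 1 ->
  Rabs (a + th * (b - a) - c) < r.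
Proof.
  intros Ha Hb Hth.
  replace (a + th * (b - a) - c) with ((1 - th) * (a - c) + th * (b - c)) by ring.
  eapply Rle_lt_trans; [apply Rabs_triang|].
  rewrite !Rabs_mult, (Rabs_pos_eq th), (Rabs_pos_eq (1 - th)) by lra.
  assert (Hm := Rmax_lub_lt _ _ _ Ha Hb).
  assert (H1 := Rmult_le_compat_l (1 - th) _ _ ltac:(lra) (Rmax_l (Rabs (a - c)) (Rabs (b - c)))).
  assert (H2 := Rmult_le_compat_l th _ _ ltac:(lra) (Rmax_r (Rabs (a - c)) (Rabs (b - c)))).
  lra.
Qed.

Lemma mean_on_segment_spec (f g : R -> R) (c r a b : R) :
  (forall x, Rabs (x - c) < r -> is_derive f x (g x)) ->
  (forall x, Rabs (x - c) < r -> continuous g x) ->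
  Rabs (a - c) < r -> Rabs (b - c) < r ->
  f b - f a = (b - a) * mean_on_segment g a b.
Proof.
  intros Hf Hg Ha Hb.
  assert (Hseg : forall th, 0 <= th <= 1 -> Rabs (a + th * (b - a) - c) < r).
  { intros th. now apply segment_in_ball. }
  assert (H : is_RInt (fun th => (b - a) * g (a + th * (b - a))) 0 1
                (minus (f (a + 1 * (b - a))) (f (a + 0 * (b - a))))).
  { apply (is_RInt_derive (fun th => f (a + th * (b - a)))).
    - rewrite Rmin_left, Rmax_right by lra. intros th Hth.
      apply (is_derive_comp f (fun th => a + th * (b - a))).
      + apply Hf. auto.
      + auto_derive; [easy|ring].
    - rewrite Rmin_left, Rmax_right by lra. intros th Hth.
      apply continuous_Rmult; [cont|].
      apply (continuous_comp (fun th => a + th * (b - a)) g); [cont|].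
      apply Hg. auto. }
  apply (is_RInt_unique (V := R_CompleteNormedModule)) in H.
  replace (a + 1 * (b - a)) with b in H by ring.
  replace (a + 0 * (b - a)) with a in H by ring.
  unfold minus, plus, opp in H; simpl in H.
  replace (f b - f a) with (f b + - f a) by ring. rewrite <- H.
  apply (RInt_scal (V := R_CompleteNormedModule)).
  apply (ex_RInt_continuous (V := R_CompleteNormedModule)).
  rewrite Rmin_left, Rmax_right by lra. intros th Hth.
  apply (continuous_comp (fun th => a + th * (b - a)) g); [cont|].
  apply Hg. auto.
Qed.

Lemma continuous_mean_on_segment {T : UniformSpace} (g : T -> R -> R)
  (a b : T -> R) (c r : R) (p : T) :
  locally p (fun q => Rabs (a q - c) < r /\ Rabs (b q - c) < r /\
    forall x, Rabs (x - c) < r -> continuous (g q) x) ->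
  continuous a p -> continuous b p ->
  (forall x, Rabs (x - c) < r ->
     continuous (fun z : T * R => g (fst z) (snd z)) (p, x)) ->
  continuous (fun q => mean_on_segment (g q) (a q) (b q)) p.
Proof.
  intros H Ca Cb Hg. destruct (locally_singleton _ _ H) as (Ha & Hb & _).
  apply (continuous_RInt_param (fun th q => g q (a q + th * (b q - a q)))).
  - intros th Hth.
    apply (continuous_comp (fun z : R * T => (snd z, a (snd z) + fst z * (b (snd z) - a (snd z))))
      (fun z : T * R => g (fst z) (snd z))).
    + assert (continuous (fun z : R * T => a (snd z)) (th, p)).
      { apply (continuous_comp snd a); [cont|easy]. }
      assert (continuous (fun z : R * T => b (snd z)) (th, p)).
      { apply (continuous_comp snd b); [cont|easy]. }
      cont.
    + apply Hg. now apply segment_in_ball.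
  - revert H. apply filter_imp. intros q (Ha' & Hb' & Hq) th Hth.
    apply (continuous_comp (fun u => a q + u * (b q - a q)) (g q)); [cont|].
    apply Hq. now apply segment_in_ball.
Qed.

(* Hadamard's lemma along each axis: the increment of [f] telescopes into
   increments of the coordinates times continuous functions. *)
Lemma is_derive_comp3 (f f1 f2 f3 : R -> R -> R -> R) (D : R3 -> Prop)
  (a b c : R -> R) (t da db dc : R) :
  open D -> D (a t, b t, c t) ->
  (forall x y z, D (x, y, z) -> is_derive (fun s => f s y z) x (f1 x y z)) ->
  (forall x y z, D (x, y, z) -> is_derive (fun s => f x s z) y (f2 x y z)) ->
  (forall x y z, D (x, y, z) -> is_derive (fun s => f x y s) z (f3 x y z)) ->
  (forall p, D p -> continuous (fun q : R3 => f1 (fst (fst q)) (snd (fst q)) (snd q)) p) ->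
  (forall p, D p -> continuous (fun q : R3 => f2 (fst (fst q)) (snd (fst q)) (snd q)) p) ->
  (forall p, D p -> continuous (fun q : R3 => f3 (fst (fst q)) (snd (fst q)) (snd q)) p) ->
  is_derive a t da -> is_derive b t db -> is_derive c t dc ->
  is_derive (fun s => f (a s) (b s) (c s)) t
    (da * f1 (a t) (b t) (c t) + db * f2 (a t) (b t) (c t) + dc * f3 (a t) (b t) (c t)).
Proof.
  intros HD HDt Hf1 Hf2 Hf3 C1 C2 C3 Ha Hb Hc.
  destruct (HD _ HDt) as [r Hr].
  assert (Hball : forall x y z, Rabs (x - a t) < r -> Rabs (y - b t) < r ->
            Rabs (z - c t) < r -> D (x, y, z)).
  { intros x y z Hx Hy Hz. apply Hr. repeat split; assumption. }
  assert (Hr0 : Rabs 0 < r) by (rewrite Rabs_R0; apply cond_pos).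
  assert (Ca : continuous a t) by (apply is_derive_continuous with da; assumption).
  assert (Cb : continuous b t) by (apply is_derive_continuous with db; assumption).
  assert (Cc : continuous c t) by (apply is_derive_continuous with dc; assumption).
  assert (Hloc : locally t (fun s =>
            Rabs (a s - a t) < r /\ Rabs (b s - b t) < r /\ Rabs (c s - c t) < r)).
  { repeat apply filter_and;
      [apply (proj1 (continuous_Rabs_lt a t))|apply (proj1 (continuous_Rabs_lt b t))
      |apply (proj1 (continuous_Rabs_lt c t))]; assumption. }
  (* The coordinates are moved one at a time, [a] first while [b] and [c] are already at time [s].
     The factors [a s - a t] and so on vanish at [t], so these mean values need only be continuous
     there. *)
  set (M1 := fun s => mean_on_segment (fun x => f1 x (b s) (c s)) (a t) (a s)).
  set (M2 := fun s => mean_on_segment (fun y => f2 (a t) y (c s)) (b t) (b s)).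
  set (M3 := fun s => mean_on_segment (fun z => f3 (a t) (b t) z) (c t) (c s)).
  assert (E1 : M1 t = f1 (a t) (b t) (c t)) by exact (mean_on_segment_refl (fun x => f1 x (b t) (c t)) (a t)).
  assert (E2 : M2 t = f2 (a t) (b t) (c t)) by exact (mean_on_segment_refl (fun y => f2 (a t) y (c t)) (b t)).
  assert (E3 : M3 t = f3 (a t) (b t) (c t)) by exact (mean_on_segment_refl (fun z => f3 (a t) (b t) z) (c t)).
  apply (is_derive_ext_loc (fun s => f (a t) (b t) (c t) +
    ((a s - a t) * M1 s + (b s - b t) * M2 s + (c s - c t) * M3 s))).
  - revert Hloc. apply filter_imp. intros s (Hsa & Hsb & Hsc).
    assert (D1 : f (a s) (b s) (c s) - f (a t) (b s) (c s) = (a s - a t) * M1 s).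
    { apply (mean_on_segment_spec (fun x => f x (b s) (c s))
        (fun x => f1 x (b s) (c s)) (a t) r (a t) (a s)).
      - intros x Hx. apply Hf1, Hball; auto.
      - intros x Hx. apply (continuous_comp (fun y => (y, b s, c s))
          (fun q : R3 => f1 (fst (fst q)) (snd (fst q)) (snd q))); [cont|].
        apply C1, Hball; auto.
      - now rewrite Rminus_diag.
      - assumption. }
    assert (D2 : f (a t) (b s) (c s) - f (a t) (b t) (c s) = (b s - b t) * M2 s).
    { apply (mean_on_segment_spec (fun y => f (a t) y (c s))
        (fun y => f2 (a t) y (c s)) (b t) r (b t) (b s)).
      - intros x Hx. apply Hf2, Hball; rewrite ?Rminus_diag; auto.
      - intros x Hx. apply (continuous_comp (fun y => (a t, y, c s))
          (fun q : R3 => f2 (fst (fst q)) (snd (fst q)) (snd q))); [cont|].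
        apply C2, Hball; rewrite ?Rminus_diag; auto.
      - now rewrite Rminus_diag.
      - assumption. }
    assert (D3 : f (a t) (b t) (c s) - f (a t) (b t) (c t) = (c s - c t) * M3 s).
    { apply (mean_on_segment_spec (fun z => f (a t) (b t) z)
        (fun z => f3 (a t) (b t) z) (c t) r (c t) (c s)).
      - intros x Hx. apply Hf3, Hball; rewrite ?Rminus_diag; auto.
      - intros x Hx. apply (continuous_comp (fun z => (a t, b t, z))
          (fun q : R3 => f3 (fst (fst q)) (snd (fst q)) (snd q))); [cont|].
        apply C3, Hball; rewrite ?Rminus_diag; auto.
      - now rewrite Rminus_diag.
      - assumption. }
    rewrite <- D1, <- D2, <- D3. Rring.
  - rewrite <- E1, <- E2, <- E3, <- Rplus_0_l.
    assert (Hsub : forall (g : R -> R) (dg : R), is_derive g t dg ->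
              is_derive (fun s => g s - g t) t dg).
    { intros g dg Hg. rewrite <- (Rminus_0_r dg).
      apply is_derive_Rminus; [exact Hg|apply is_derive_Rconst]. }
    apply is_derive_Rplus; [apply is_derive_Rconst|].
    repeat apply is_derive_Rplus.
    + apply (is_derive_mult_vanish (fun s => a s - a t) M1); [auto|ring|].
      apply (continuous_mean_on_segment (fun s x => f1 x (b s) (c s)) 
        (fun _ => a t) a (a t) r t).
      * revert Hloc. apply filter_imp. intros s (Hsa & Hsb & Hsc).
        rewrite Rminus_diag. repeat split; auto.
        intros x Hx. apply (continuous_comp (fun y => (y, b s, c s))
          (fun q : R3 => f1 (fst (fst q)) (snd (fst q)) (snd q))); [cont|].
        apply C1, Hball; auto.
      * cont.
      * assumption.
      * intros x Hx.
        apply (continuous_comp (fun z : R * R => (snd z, b (fst z), c (fst z)))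
          (fun q : R3 => f1 (fst (fst q)) (snd (fst q)) (snd q))).
        -- cont; [apply (continuous_comp fst b)|apply (continuous_comp fst c)]; cont.
        -- apply C1, Hball; rewrite ?Rminus_diag; auto.
    + apply (is_derive_mult_vanish (fun s => b s - b t) M2); [auto|ring|].
      apply (continuous_mean_on_segment (fun s x => f2 (a t) x (c s)) 
        (fun _ => b t) b (b t) r t).
      * revert Hloc. apply filter_imp. intros s (Hsa & Hsb & Hsc).
        rewrite Rminus_diag. repeat split; auto.
        intros x Hx. apply (continuous_comp (fun y => (a t, y, c s))
          (fun q : R3 => f2 (fst (fst q)) (snd (fst q)) (snd q))); [cont|].
        apply C2, Hball; rewrite ?Rminus_diag; auto.
      * cont.
      * assumption.
      * intros x Hx.
        apply (continuous_comp (fun z : R * R => (a t, snd z, c (fst z)))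
          (fun q : R3 => f2 (fst (fst q)) (snd (fst q)) (snd q))).
        -- cont; apply (continuous_comp fst c); cont.
        -- apply C2, Hball; rewrite ?Rminus_diag; auto.
    + apply (is_derive_mult_vanish (fun s => c s - c t) M3); [auto|ring|].
      apply (continuous_mean_on_segment (fun s x => f3 (a t) (b t) x) 
        (fun _ => c t) c (c t) r t).
      * revert Hloc. apply filter_imp. intros s (Hsa & Hsb & Hsc).
        rewrite Rminus_diag. repeat split; auto.
        intros x Hx. apply (continuous_comp (fun y => (a t, b t, y))
          (fun q : R3 => f3 (fst (fst q)) (snd (fst q)) (snd q))); [cont|].
        apply C3, Hball; rewrite ?Rminus_diag; auto.
      * cont.
      * assumption.
      * intros x Hx.
        apply (continuous_comp (fun z : R * R => (a t, b t, snd z))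
          (fun q : R3 => f3 (fst (fst q)) (snd (fst q)) (snd q))); [cont|].
        apply C3, Hball; rewrite ?Rminus_diag; auto.
Qed.

(** * Linear scalar equations and dependence on parameters *)

(** Variation of constants for [y' = a y + b], [y(0) = c]. *)
Definition lin_sol (a b : R -> R) (c t : R) : R :=
  exp (RInt a 0 t) * (c + RInt (fun s => b s * exp (- RInt a 0 s)) 0 t).

Lemma lin_sol_0 (a b : R -> R) (c : R) : lin_sol a b c 0 = c.
Proof.
  unfold lin_sol. rewrite !RInt_point. unfold zero; simpl. rewrite exp_0. ring.
Qed.

Section LinearODE.

Context (a b : R -> R) (tau : R).
Hypothesis Ca : forall s, Rabs s < tau -> continuous a s.
Hypothesis Cb : forall s, Rabs s < tau -> continuous b s.

Lemma is_derive_lin_sol (c t : R) :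
  Rabs t < tau -> is_derive (lin_sol a b c) t (a t * lin_sol a b c t + b t).
Proof.
  intros Ht.
  assert (Ha := fun s => is_derive_RInt_from_0 a tau s Ca).
  assert (Hb : forall s, Rabs s < tau ->
            continuous (fun s => b s * exp (- RInt a 0 s)) s).
  { intros s Hs.
    assert (C := is_derive_continuous _ _ _ (Ha s Hs)).
    assert (C' := Cb s Hs). cont. }
  eapply is_derive_eq.
  - apply is_derive_Rmult.
    + apply is_derive_Rexp, Ha, Ht.
    + apply is_derive_Rplus; [apply is_derive_Rconst|].
      apply (is_derive_RInt_from_0 _ tau _ Hb Ht).
  - unfold lin_sol. rewrite exp_Ropp. field. apply Rgt_not_eq, exp_pos.
Qed.

(** The integrating factor turns the difference of two solutions into a constant [N]. The factor
    [kappa] will be an increment of a parameter: keeping it outside [lin_sol] exhibits a slope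
    without dividing by an increment that may be 0. *)
Lemma linear_ODE_unique (D : R -> R) (c kappa : R) :
  (forall s, Rabs s < tau -> is_derive D s (a s * D s + kappa * b s)) ->
  D 0 = kappa * c ->
  forall t, Rabs t < tau -> D t = kappa * lin_sol a b c t.
Proof.
  intros HD HD0 t Ht.
  set (N := fun s => (D s - kappa * lin_sol a b c s) * exp (- RInt a 0 s)).
  assert (HN : forall s, Rabs s < tau -> is_derive N s 0).
  { intros s Hs. eapply is_derive_eq.
    - apply is_derive_Rmult.
      + apply is_derive_Rminus; [apply (HD s Hs)|].
        apply is_derive_Rmult; [apply is_derive_Rconst|].
        apply (is_derive_lin_sol c s Hs).
      + apply is_derive_Rexp, is_derive_Ropp, (is_derive_RInt_from_0 a tau s Ca Hs).
    - cbv beta. ring. }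
  destruct (MVT_gen N 0 t (fun _ => 0)) as (x & _ & Hx).
  - intros x Hx. apply HN. apply between_Rabs_lt with t; [assumption|lra].
  - intros x Hx. apply continuity_pt_filterlim.
    apply (is_derive_continuous N x 0). apply HN.
    now apply between_Rabs_lt with t.
  - assert (N0 : N 0 = 0) by (unfold N; rewrite lin_sol_0, HD0; ring).
    assert (Nt : N t = 0) by lra.
    unfold N in Nt. apply Rmult_integral in Nt. destruct Nt as [Nt|Nt]; [lra|].
    assert (H := exp_pos (- RInt a 0 t)). lra.
Qed.

End LinearODE.

Lemma continuous_lin_sol {T : UniformSpace} (a b : R -> T -> R) (c tau t : R)
  (D : T -> Prop) (p : T) :
  open D ->
  (forall s q, Rabs s < tau -> D q ->
     continuous (fun z : R * T => a (fst z) (snd z)) (s, q)) ->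
  (forall s q, Rabs s < tau -> D q ->
     continuous (fun z : R * T => b (fst z) (snd z)) (s, q)) ->
  Rabs t < tau -> D p ->
  continuous (fun z : R * T =>
    lin_sol (fun s => a s (snd z)) (fun s => b s (snd z)) c (fst z)) (t, p).
Proof.
  intros HD Ha Hb Ht Hp. unfold lin_sol.
  assert (Ca : forall s q, Rabs s < tau -> D q ->
     continuous (fun z : R * T => RInt (fun s => a s (snd z)) 0 (fst z)) (s, q)).
  { intros s q Hs Hq. now apply (continuous_RInt_param_from_0 a D tau). }
  assert (Cb : continuous (fun z : R * T =>
     RInt (fun s => b s (snd z) * exp (- RInt (fun s => a s (snd z)) 0 s)) 0 (fst z)) (t, p)).
  { apply (continuous_RInt_param_from_0
      (fun s q => b s q * exp (- RInt (fun s => a s q) 0 s)) D tau); auto.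
    intros s q Hs Hq. assert (H1 := Ca s q Hs Hq). assert (H2 := Hb s q Hs Hq). cont. }
  assert (H := Ca t p Ht Hp). cont.
Qed.

Lemma open_Rabs_lt (c r : R) : open (fun x : R => Rabs (x - c) < r).
Proof.
  intros x Hx. assert (H : 0 < r - Rabs (x - c)) by lra.
  apply locally_Rabs. exists (mkposreal _ H). simpl. intros y Hy.
  replace (y - c) with ((y - x) + (x - c)) by ring.
  eapply Rle_lt_trans; [apply Rabs_triang|lra].
Qed.

(* The increment of a flow in a parameter solves, by Hadamard's lemma, a linear
   ODE whose coefficients depend continuously on the parameter. *)
Lemma is_derive_flow_param (h hw he : R -> R -> R -> R) (W : R -> R -> R)
  (tau e0 rho w0 r c t : R) :
  0 < rho ->
  (forall s e w, Rabs s < tau -> Rabs (e - e0) < rho -> Rabs (w - w0) < r ->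
     is_derive (fun w => h s e w) w (hw s e w)) ->
  (forall s e w, Rabs s < tau -> Rabs (e - e0) < rho -> Rabs (w - w0) < r ->
     is_derive (fun e => h s e w) e (he s e w)) ->
  (forall s e w, Rabs s < tau -> Rabs (e - e0) < rho -> Rabs (w - w0) < r ->
     continuous (fun q : R3 => hw (fst (fst q)) (snd (fst q)) (snd q)) (s, e, w)) ->
  (forall s e w, Rabs s < tau -> Rabs (e - e0) < rho -> Rabs (w - w0) < r ->
     continuous (fun q : R3 => he (fst (fst q)) (snd (fst q)) (snd q)) (s, e, w)) ->
  (forall s e, Rabs s < tau -> Rabs (e - e0) < rho -> Rabs (W s e - w0) < r) ->
  (forall s e, Rabs s < tau -> Rabs (e - e0) < rho ->
     continuous (fun z : R * R => W (fst z) (snd z)) (s, e)) ->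
  (forall s e, Rabs s < tau -> Rabs (e - e0) < rho ->
     is_derive (fun s => W s e) s (h s e (W s e))) ->
  (forall e, Rabs (e - e0) < rho -> W 0 e - W 0 e0 = (e - e0) * c) ->
  Rabs t < tau ->
  is_derive (fun e => W t e) e0
    (lin_sol (fun s => hw s e0 (W s e0)) (fun s => he s e0 (W s e0)) c t).
Proof.
  intros Hrho Dw De Cw Ce HW CW DW HW0 Ht.
  assert (He0 : Rabs (e0 - e0) < rho) by now rewrite Rminus_diag, Rabs_R0.
  set (a := fun s e => mean_on_segment (fun w => hw s e w) (W s e0) (W s e)).
  set (b := fun s e => mean_on_segment (fun x => he s x (W s e0)) e0 e).
  (* At [e = e0] the mean values collapse to the partial derivatives, so the claimed derivative is
     the value at [e0] of the slope in [e] built from [a] and [b]. *)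
  assert (Ha0 : (fun s => hw s e0 (W s e0)) = (fun s => a s e0)).
  { apply functional_extensionality. intros s. symmetry.
    exact (mean_on_segment_refl (fun w => hw s e0 w) (W s e0)). }
  assert (Hb0 : (fun s => he s e0 (W s e0)) = (fun s => b s e0)).
  { apply functional_extensionality. intros s. symmetry.
    exact (mean_on_segment_refl (fun x => he s x (W s e0)) e0). }
  assert (Cw' : forall s e w, Rabs s < tau -> Rabs (e - e0) < rho -> Rabs (w - w0) < r ->
            continuous (hw s e) w).
  { intros s e w Hs He Hw. apply (continuous_comp (fun w => (s, e, w))
      (fun q : R3 => hw (fst (fst q)) (snd (fst q)) (snd q))); [cont|auto]. }
  assert (Ce' : forall s e w, Rabs s < tau -> Rabs (e - e0) < rho -> Rabs (w - w0) < r ->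
            continuous (fun x => he s x w) e).
  { intros s e w Hs He Hw. apply (continuous_comp (fun e => (s, e, w))
      (fun q : R3 => he (fst (fst q)) (snd (fst q)) (snd q))); [cont|auto]. }
  assert (Hloc : forall s e, Rabs s < tau -> Rabs (e - e0) < rho ->
            locally (s, e) (fun z : R * R => Rabs (fst z) < tau /\ Rabs (snd z - e0) < rho)).
  { intros s e Hs He. apply filter_and.
    - apply (continuous_fst s e (fun s => Rabs s < tau)). now apply locally_Rabs_lt.
    - apply (continuous_snd s e (fun e => Rabs (e - e0) < rho)). now apply open_Rabs_lt. }
  assert (CW0 : forall s e, Rabs s < tau ->
            continuous (fun z : R * R => W (fst z) e0) (s, e)).
  { intros s e Hs. apply (continuous_comp (fun z : R * R => (fst z, e0))
      (fun z : R * R => W (fst z) (snd z))); [cont|auto]. }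
  assert (Ca : forall s e, Rabs s < tau -> Rabs (e - e0) < rho ->
            continuous (fun z : R * R => a (fst z) (snd z)) (s, e)).
  { intros s e Hs He.
    apply (continuous_mean_on_segment (fun (z : R * R) w => hw (fst z) (snd z) w)
      (fun z => W (fst z) e0) (fun z => W (fst z) (snd z)) w0 r (s, e)); auto.
    generalize (Hloc s e Hs He). apply filter_imp. intros [s' e'] [Hs' He']; simpl in *.
    split; [|split]; auto. }
  assert (Cb : forall s e, Rabs s < tau -> Rabs (e - e0) < rho ->
            continuous (fun z : R * R => b (fst z) (snd z)) (s, e)).
  { intros s e Hs He.
    apply (continuous_mean_on_segment (fun (z : R * R) x => he (fst z) x (W (fst z) e0))
      (fun z => e0) (fun z => snd z) e0 rho (s, e)).
    - generalize (Hloc s e Hs He). apply filter_imp. intros [s' e'] [Hs' He']; simpl in *.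
      split; [|split]; auto.
    - cont.
    - cont.
    - intros x Hx.
      apply (continuous_comp (fun z : R * R * R => (fst (fst z), snd z, W (fst (fst z)) e0))
        (fun q : R3 => he (fst (fst q)) (snd (fst q)) (snd q))).
      + cont. apply (continuous_comp fst (fun z : R * R => W (fst z) e0)); [cont|].
        apply CW0; auto.
      + apply Ce; auto. }
  rewrite Ha0, Hb0.
  apply (is_derive_of_slope _ (fun e => lin_sol (fun s => a s e) (fun s => b s e) c t)).
  - apply (filter_imp (fun e => Rabs (e - e0) < rho)).
    + intros e He.
      apply (linear_ODE_unique (fun s => a s e) (fun s => b s e) tau)
        with (D := fun s => W s e - W s e0); auto.
      * intros s Hs. apply (continuous_section a). auto.
      * intros s Hs. apply (continuous_section b). auto.
      * intros s Hs.
        eapply is_derive_eq; [apply is_derive_Rminus; apply DW; auto|].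
        (* The increment of [h] is split at [h s e (W s e0)]: [a] accounts for the change of [w] at
           fixed [e], [b] for the change of [e] at [w = W s e0]. *)
        unfold a, b. rewrite (Rmult_comm (mean_on_segment _ _ _)).
        rewrite <- (mean_on_segment_spec (fun w => h s e w) (fun w => hw s e w) w0 r);
          auto.
        rewrite <- (mean_on_segment_spec (fun x => h s x (W s e0))
          (fun x => he s x (W s e0)) e0 rho); auto.
        ring.
    + now apply open_Rabs_lt.
  - apply (continuous_comp (fun e => (t, e)) (fun z : R * R =>
      lin_sol (fun s => a s (snd z)) (fun s => b s (snd z)) c (fst z))); [cont|].
    apply (continuous_lin_sol a b c tau t (fun e => Rabs (e - e0) < rho)); auto.
    apply open_Rabs_lt.
Qed.

(** * Fixed points of integral operators *)

Lemma Rabs_le_pow_half (x M : R) : (forall n, Rabs x <= M * (/ 2) ^ n) -> x = 0.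
Proof.
  intros H. apply Rabs_eq_0. apply Rle_antisym; [|apply Rabs_pos].
  assert (HL : is_lim_seq (fun n => M * (/ 2) ^ n) 0).
  { replace (Finite 0) with (Rbar_mult M 0) by (simpl; f_equal; ring).
    apply is_lim_seq_scal_l. apply is_lim_seq_geom. rewrite Rabs_pos_eq; lra. }
  exact (is_lim_seq_le (fun _ => Rabs x) _ (Rabs x) 0 H (is_lim_seq_const _) HL).
Qed.

Section FixedPoint.

Context {Q : UniformSpace} (c : Q -> R) (k : Q -> R -> R -> R) (psi : Q -> R -> Q) (M : R).
Hypothesis Cc : forall q, continuous c q.
Hypothesis continuous_k : forall q th w,
  continuous (fun z : Q * R * R => k (fst (fst z)) (snd (fst z)) (snd z)) (q, th, w).
Hypothesis Cpsi : forall q th,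
  continuous (fun z : Q * R => psi (fst z) (snd z)) (q, th).
Hypothesis k_lip : forall q th w w',
  Rabs (k q th w - k q th w') <= / 2 * Rabs (w - w').
Hypothesis k_bound : forall q th w, Rabs (k q th w) <= M.

(** With [Q] the pairs (time, parameter) and [psi (t, p) th = (t * th, p)], this is the Picard
    operator with its integral rescaled to [[0, 1]]. *)
Let step (Z : Q -> R) (q : Q) : R := c q + RInt (fun th => k q th (Z (psi q th))) 0 1.

Let Ck_step (Z : Q -> R) : (forall q, continuous Z q) ->
  forall q th, continuous (fun z : R * Q => k (snd z) (fst z) (Z (psi (snd z) (fst z)))) (th, q).
Proof.
  intros CZ q th.
  apply (continuous_comp (fun z : R * Q => (snd z, fst z, Z (psi (snd z) (fst z))))
    (fun z : Q * R * R => k (fst (fst z)) (snd (fst z)) (snd z))); [cont|apply continuous_k].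
  apply (continuous_comp (fun z : R * Q => psi (snd z) (fst z)) Z); [|apply CZ].
  apply (continuous_comp (fun z : R * Q => (snd z, fst z))
    (fun z : Q * R => psi (fst z) (snd z))); [cont|apply Cpsi].
Qed.

Let ex_RInt_step (Z : Q -> R) : (forall q, continuous Z q) ->
  forall q, ex_RInt (fun th => k q th (Z (psi q th))) 0 1.
Proof.
  intros CZ q. apply (ex_RInt_continuous (V := R_CompleteNormedModule)).
  intros th _. apply (continuous_section (fun th q => k q th (Z (psi q th)))).
  now apply Ck_step.
Qed.

Let continuous_step (Z : Q -> R) :
  (forall q, continuous Z q) -> forall q, continuous (step Z) q.
Proof.
  intros CZ q. unfold step. apply continuous_Rplus; [apply Cc|].
  apply (continuous_RInt_param (fun th q => k q th (Z (psi q th)))).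
  - intros th _. now apply Ck_step.
  - apply filter_forall. intros q' th _.
    apply (continuous_section (fun th q => k q th (Z (psi q th)))). now apply Ck_step.
Qed.

Let step_contract (Z Z' : Q -> R) (d : R) :
  (forall q, continuous Z q) -> (forall q, continuous Z' q) ->
  (forall q, Rabs (Z q - Z' q) <= d) ->
  forall q, Rabs (step Z q - step Z' q) <= / 2 * d.
Proof.
  intros CZ CZ' Hd q. unfold step.
  rewrite Rminus_plus_l_l.
  rewrite <- (RInt_minus (V := R_CompleteNormedModule)) by auto.
  replace (/ 2 * d) with ((1 - 0) * (/ 2 * d)) by ring.
  apply abs_RInt_le_const; [lra| |].
  - apply (ex_RInt_minus (V := R_NormedModule)); auto.
  - intros th _. eapply Rle_trans; [apply k_lip|].
    apply Rmult_le_compat_l; [lra|apply Hd].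
Qed.

Let Zn (n : nat) : Q -> R := Nat.iter n step c.

Let continuous_Zn (n : nat) : forall q, continuous (Zn n) q.
Proof.
  induction n as [|n IH]; [exact Cc|]. exact (continuous_step _ IH).
Qed.

Let Zn_step (n : nat) : forall q, Rabs (Zn (S n) q - Zn n q) <= M * (/ 2) ^ n.
Proof.
  induction n as [|n IH]; intros q.
  - simpl. unfold step.
    rewrite Rplus_minus_l.
    replace (M * 1) with ((1 - 0) * M) by ring.
    apply abs_RInt_le_const; [lra|now apply ex_RInt_step|auto].
  - replace (M * (/ 2) ^ S n) with (/ 2 * (M * (/ 2) ^ n)) by (simpl; ring).
    exact (step_contract (Zn (S n)) (Zn n) _ (continuous_Zn _) (continuous_Zn _) IH q).
Qed.

(** The bound is the exact sum of the geometric terms from [n] to [n + m - 1]; the subtracted term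
    lets the induction on [m] close. *)
Let Zn_tail (n m : nat) (q : Q) :
  Rabs (Zn (n + m) q - Zn n q) <= 2 * M * (/ 2) ^ n - 2 * M * (/ 2) ^ (n + m).
Proof.
  induction m as [|m IH].
  - rewrite Nat.add_0_r, Rminus_diag, Rminus_diag, Rabs_R0. lra.
  - replace (n + S m)%nat with (S (n + m)) by lia.
    replace (Zn (S (n + m)) q - Zn n q) with
      ((Zn (S (n + m)) q - Zn (n + m)%nat q) + (Zn (n + m)%nat q - Zn n q)) by ring.
    eapply Rle_trans; [apply Rabs_triang|].
    assert (H := Zn_step (n + m) q). simpl pow. lra.
Qed.

(** Banach's argument in the sup distance: [step] halves distances and [M] bounds the first
    displacement, so the iterates converge uniformly and the limit is continuous in all
    variables. *)
Lemma ex_fixed_point : exists Z : Q -> R,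
  (forall q, continuous Z q) /\
  forall q, Z q = c q + RInt (fun th => k q th (Z (psi q th))) 0 1.
Proof.
  assert (HM : forall q : Q, 0 <= M).
  { intros q. eapply Rle_trans; [apply Rabs_pos|apply (k_bound q 0 0)]. }
  assert (Hpow : forall n, 0 < (/ 2) ^ n) by (intros n; apply pow_lt; lra).
  assert (Hcv : forall q, ex_finite_lim_seq (fun n => Zn n q)).
  { intros q. apply ex_lim_seq_cauchy_corr. intros eps.
    assert (HL : is_lim_seq (fun n => 2 * M * (/ 2) ^ n) 0).
    { replace (Finite 0) with (Rbar_mult (2 * M) 0) by (simpl; f_equal; ring).
      apply is_lim_seq_scal_l, is_lim_seq_geom. rewrite Rabs_pos_eq; lra. }
    apply is_lim_seq_spec in HL.
    assert (He : 0 < eps / 2) by (destruct eps; simpl; lra).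
    destruct (HL (mkposreal _ He)) as [N HN]. exists N.
    assert (HN' : forall n, (N <= n)%nat -> Rabs (Zn n q - Zn N q) < eps / 2).
    { intros n Hn. replace n with (N + (n - N))%nat by lia.
      eapply Rle_lt_trans; [apply Zn_tail|].
      specialize (HN N (le_n _)). simpl in HN. rewrite Rminus_0_r in HN.
      apply Rabs_def2 in HN. specialize (HM q).
      assert (0 <= M * (/ 2) ^ (N + (n - N))).
      { apply Rmult_le_pos; [assumption|left; apply Hpow]. }
      lra. }
    intros n m Hn Hm. assert (H1 := HN' n Hn). assert (H2 := HN' m Hm).
    replace (Zn n q - Zn m q) with ((Zn n q - Zn N q) - (Zn m q - Zn N q)) by ring.
    eapply Rle_lt_trans; [apply Rabs_triang|]. rewrite Rabs_Ropp. lra. }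
  set (Z := fun q => real (Lim_seq (fun n => Zn n q))).
  assert (HZ : forall q, is_lim_seq (fun n => Zn n q) (Z q)).
  { intros q. now apply Lim_seq_correct'. }
  assert (Hdist : forall n q, Rabs (Z q - Zn n q) <= 2 * M * (/ 2) ^ n).
  { intros n q.
    apply (is_lim_seq_le (fun m => Rabs (Zn (n + m) q - Zn n q))
      (fun _ => 2 * M * (/ 2) ^ n) (Rabs (Z q - Zn n q)) (2 * M * (/ 2) ^ n)).
    - intros m. eapply Rle_trans; [apply Zn_tail|].
      assert (0 <= M * (/ 2) ^ (n + m)).
      { apply Rmult_le_pos; [now apply HM|left; apply Hpow]. }
      lra.
    - apply (is_lim_seq_abs _ (Z q - Zn n q)).
      apply is_lim_seq_minus'; [|apply is_lim_seq_const].
      apply (is_lim_seq_ext (fun m => Zn (m + n) q)).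
      { intros m. now rewrite Nat.add_comm. }
      apply (is_lim_seq_incr_n (fun m => Zn m q) n (Z q)), HZ.
    - apply is_lim_seq_const. }
  assert (CZ : forall q, continuous Z q).
  { intros q. apply continuous_Rabs_lt. intros eps.
    assert (He : 0 < eps / 3) by (destruct eps; simpl; lra).
    assert (HL : is_lim_seq (fun n => 2 * M * (/ 2) ^ n) 0).
    { replace (Finite 0) with (Rbar_mult (2 * M) 0) by (simpl; f_equal; ring).
      apply is_lim_seq_scal_l, is_lim_seq_geom. rewrite Rabs_pos_eq; lra. }
    apply is_lim_seq_spec in HL.
    destruct (HL (mkposreal _ He)) as [N HN].
    specialize (HN N (le_n _)). simpl in HN. rewrite Rminus_0_r in HN.
    apply Rabs_def2 in HN.
    generalize (proj1 (continuous_Rabs_lt _ _) (continuous_Zn N q) (mkposreal _ He)).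
    apply filter_imp. simpl. intros q' Hq'.
    assert (H1 := Hdist N q). assert (H2 := Hdist N q').
    replace (Z q' - Z q) with ((Z q' - Zn N q') + (Zn N q' - Zn N q) - (Z q - Zn N q)) by ring.
    eapply Rle_lt_trans; [apply Rabs_triang|]. rewrite Rabs_Ropp.
    eapply Rle_lt_trans; [apply Rplus_le_compat_r, Rabs_triang|]. lra. }
  exists Z. split; [exact CZ|]. intros q.
  apply Rminus_diag_uniq. apply (Rabs_le_pow_half _ (2 * M)). intros n.
  change (Rabs (Z q - step Z q) <= 2 * M * (/ 2) ^ n).
  (* [Zn (S n)] is [step (Zn n)]. Each of the two differences is at most [M * (/ 2) ^ n], the first
     by the distance to the limit and the second by contraction. *)
  replace (Z q - step Z q) with ((Z q - Zn (S n) q) - (step Z q - step (Zn n) q))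
    by (simpl; ring).
  eapply Rle_trans; [apply Rabs_triang|]. rewrite Rabs_Ropp.
  assert (H1 := Hdist (S n) q).
  assert (H2 := step_contract Z (Zn n) _ CZ (continuous_Zn n) (Hdist n) q).
  simpl pow in H1. lra.
Qed.

End FixedPoint.

(** * Flows of scalar equations *)

(** The 1-Lipschitz retraction onto [[c - d, c + d]]. Composing with it extends a local right-hand
    side to all arguments with the same bound and Lipschitz constant. *)
Definition clamp (c d x : R) : R := Rmax (c - d) (Rmin (c + d) x).

Lemma clamp_range (c d x : R) : 0 <= d -> Rabs (clamp c d x - c) <= d.
Proof.
  intros Hd. unfold clamp, Rmax, Rmin, Rabs.
  repeat destruct Rle_dec; repeat destruct Rcase_abs; lra.
Qed.

Lemma clamp_id (c d x : R) : Rabs (x - c) <= d -> clamp c d x = x.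
Proof.
  intros Hx. unfold clamp, Rmax, Rmin, Rabs in *.
  repeat destruct Rle_dec; repeat destruct Rcase_abs; lra.
Qed.

Lemma clamp_lipschitz (c d x y : R) : Rabs (clamp c d x - clamp c d y) <= Rabs (x - y).
Proof.
  unfold clamp, Rmax, Rmin, Rabs.
  repeat destruct Rle_dec; repeat destruct Rcase_abs; lra.
Qed.

Lemma continuous_clamp {T : UniformSpace} (c d : R) (f : T -> R) (x : T) :
  continuous f x -> continuous (fun t => clamp c d (f t)) x.
Proof.
  intros Hf. apply continuous_Rabs_lt. intros eps.
  generalize (proj1 (continuous_Rabs_lt _ _) Hf eps). apply filter_imp.
  intros y Hy. eapply Rle_lt_trans; [apply clamp_lipschitz|exact Hy].
Qed.

(** Time goes up to 2 so that time 1, where the leaf arrives above the base point, is an interior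
    time. *)
Definition flow_domain (p0 : R3) (d rho : R) (s : R) (p : R3) (w : R) : Prop :=
  Rabs s <= 2 /\ (forall i, Rabs (coord i p - coord i p0) <= d) /\
  Rabs (w - coord ax3 p0) <= rho.

(** Continuity is claimed everywhere, since the flow is built from a clamped right-hand side; the
    equation only where clamping changes nothing. *)
Definition is_flow (p0 : R3) (d rho : R) (G : R -> R3 -> R -> R) (W : R -> R3 -> R) : Prop :=
  (forall z, continuous (fun z : R * R3 => W (fst z) (snd z)) z) /\
  (forall p, W 0 p = coord ax3 p) /\
  (forall (t : R) (p : R3), Rabs t < 2 -> ball p0 d p -> Rabs (W t p - coord ax3 p0) < rho) /\
  (forall (t : R) (p : R3), Rabs t < 2 -> ball p0 d p -> is_derive (fun t => W t p) t (G t p (W t p))).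

Lemma ball_R3 (p0 p : R3) (d : R) :
  ball p0 d p <-> forall i, Rabs (coord i p - coord i p0) < d.
Proof.
  split.
  - intros [[H1 H2] H3] []; assumption.
  - intros H. split; [split|]; [apply (H ax1)|apply (H ax2)|apply (H ax3)].
Qed.

(** Over times up to 2, the Lipschitz constant [/ 4] becomes the contraction factor [/ 2], and a
    path that starts within [d] and has speed at most [M] stays within [d + 2 * M] of the centre. *)
Lemma ex_flow (G : R -> R3 -> R -> R) (p0 : R3) (d rho M : R) :
  0 < d -> 0 <= M ->
  (forall s p w, flow_domain p0 d rho s p w ->
     continuous (fun z : R * R3 * R => G (fst (fst z)) (snd (fst z)) (snd z)) (s, p, w)) ->
  (forall s p w, flow_domain p0 d rho s p w -> Rabs (G s p w) <= M) ->
  (forall s p w w', flow_domain p0 d rho s p w -> flow_domain p0 d rho s p w' ->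
     Rabs (G s p w - G s p w') <= / 4 * Rabs (w - w')) ->
  d + 2 * M <= rho ->
  exists W, is_flow p0 d rho G W.
Proof.
  intros Hd HM0 CG HM HL Hrho.
  set (cl := fun p : R3 => (clamp (coord ax1 p0) d (coord ax1 p),
    clamp (coord ax2 p0) d (coord ax2 p), clamp (coord ax3 p0) d (coord ax3 p)) : R3).
  set (clw := clamp (coord ax3 p0) rho).
  set (clt := clamp 0 2).
  assert (Hdom : forall s p w, flow_domain p0 d rho (clt s) (cl p) (clw w)).
  { intros s p w. split; [|split].
    - rewrite <- (Rminus_0_r (clt s)). apply clamp_range. lra.
    - intros []; apply clamp_range; lra.
    - apply clamp_range. lra. }
  assert (Hclt : forall t, Rabs t < 2 -> clt t = t).
  { intros t Ht. apply clamp_id. rewrite Rminus_0_r. lra. }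
  assert (Hcl : forall p : R3, ball p0 d p -> cl p = p).
  { intros [[x y] z] Hp. rewrite ball_R3 in Hp. unfold cl.
    assert (H1 := Hp ax1). assert (H2 := Hp ax2). assert (H3 := Hp ax3).
    rewrite !clamp_id by lra. reflexivity. }
  (* The leading factor is the Jacobian of the rescaling to [[0, 1]]; the clamps make [k]
     continuous, bounded and contracting on the whole space. *)
  set (k := fun (q : R * R3) th w =>
    clt (fst q) * G (clt (fst q * th)) (cl (snd q)) (clw w)).
  assert (Ccl : forall p, continuous cl p).
  { intros p. unfold cl, coord. cont; apply continuous_clamp; cont. }
  assert (Ckk : forall q th w,
    continuous (fun z : R * R3 * R * R => k (fst (fst z)) (snd (fst z)) (snd z)) (q, th, w)).
  { intros q th w. unfold k.
    apply (continuous_Rmult (fun z : R * R3 * R * R => clt (fst (fst (fst z))))).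
    - apply continuous_clamp. cont.
    - apply (continuous_comp
        (fun z : R * R3 * R * R => (clt (fst (fst (fst z)) * snd (fst z)),
           cl (snd (fst (fst z))), clw (snd z)))
        (fun z : R * R3 * R => G (fst (fst z)) (snd (fst z)) (snd z))).
      + cont.
        * apply continuous_clamp. cont.
        * apply (continuous_comp (fun z : R * R3 * R * R => snd (fst (fst z))) cl);
            [cont|apply Ccl].
        * apply continuous_clamp. cont.
      + apply CG, Hdom. }
  assert (Hclt2 : forall t, Rabs (clt t) <= 2).
  { intros t. rewrite <- (Rminus_0_r (clt t)). apply clamp_range. lra. }
  assert (Hk : forall q th w, Rabs (k q th w) <= 2 * M).
  { intros q th w. unfold k. rewrite Rabs_mult.
    apply Rmult_le_compat; [apply Rabs_pos|apply Rabs_pos|apply Hclt2|apply HM, Hdom]. }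
  destruct (ex_fixed_point (fun q : R * R3 => snd (snd q)) k
    (fun q th => (fst q * th, snd q)) (2 * M)) as (Z & CZ & HZ).
  - intros q. cont.
  - exact Ckk.
  - intros q th. cont.
  - intros q th w w'. unfold k.
    rewrite <- Rmult_minus_distr_l, Rabs_mult.
    assert (H2 := HL _ _ _ _ (Hdom (fst q * th) (snd q) w) (Hdom (fst q * th) (snd q) w')).
    assert (H3 : Rabs (clw w - clw w') <= Rabs (w - w')) by apply clamp_lipschitz.
    eapply Rle_trans; [apply Rmult_le_compat;
      [apply Rabs_pos|apply Rabs_pos|apply Hclt2|exact H2]|].
    lra.
  - exact Hk.
  - assert (CZt : forall p s, continuous (fun s => Z (s, p)) s).
    { intros p s. apply (continuous_comp (fun s => (s, p)) Z); [cont|apply CZ]. }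
    assert (Hrange : forall (t : R) (p : R3), Rabs t < 2 -> ball p0 d p ->
              Rabs (Z (t, p) - coord ax3 p0) < rho).
    { intros t p Ht Hp. rewrite HZ. simpl.
      assert (H3 := proj1 (ball_R3 _ _ _) Hp ax3).
      assert (HI : Rabs (RInt (fun th => k (t, p) th (Z (t * th, p))) 0 1) <= (1 - 0) * (2 * M)).
      { apply abs_RInt_le_const; [lra| |intros; apply Hk].
        apply (ex_RInt_continuous (V := R_CompleteNormedModule)). intros th _.
        apply (continuous_comp (fun th => ((t, p), th, Z (t * th, p)))
          (fun z : R * R3 * R * R => k (fst (fst z)) (snd (fst z)) (snd z))); [|apply Ckk].
        cont. apply (continuous_comp (fun th => t * th) (fun s => Z (s, p)));
          [cont|apply CZt]. }
      simpl in H3. unfold Rminus. rewrite Rplus_assoc, (Rplus_comm (RInt _ _ _)).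
      rewrite <- Rplus_assoc.
      eapply Rle_lt_trans; [apply Rabs_triang|]. unfold Rminus in H3. lra. }
    assert (CGZ : forall p : R3, ball p0 d p -> forall s : R, Rabs s < 2 ->
              continuous (fun s => G s p (Z (s, p))) s).
    { intros p Hp s Hs. apply (continuous_comp (fun s => (s, p, Z (s, p)))
        (fun z : R * R3 * R => G (fst (fst z)) (snd (fst z)) (snd z))).
      - cont. apply CZt.
      - apply CG. split; [lra|split].
        + intros i. left. now apply ball_R3.
        + left. now apply Hrange. }
    (* The range estimate shows that every clamp is the identity along the path; undoing the
       rescaling then gives the integral form of the true equation. *)
    assert (HZI : forall (t : R) (p : R3), Rabs t < 2 -> ball p0 d p ->
              Z (t, p) = coord ax3 p + RInt (fun s => G s p (Z (s, p))) 0 t).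
    { intros t p Ht Hp. rewrite HZ at 1. simpl. f_equal.
      rewrite (RInt_rescale (fun s => G s p (Z (s, p)))).
      2:{ apply ex_RInt_from_0 with 2; auto. }
      rewrite <- (RInt_scal (V := R_CompleteNormedModule)
        (fun th => G (t * th) p (Z (t * th, p)))).
      2:{ apply (ex_RInt_continuous (V := R_CompleteNormedModule)).
          rewrite Rmin_left, Rmax_right by lra. intros th Hth.
          apply (continuous_comp (fun th => t * th) (fun s => G s p (Z (s, p)))); [cont|].
          apply CGZ; auto. now apply scaled_lt. }
      apply RInt_ext. rewrite Rmin_left, Rmax_right by lra. intros th Hth.
      unfold k; simpl.
      assert (Hs : Rabs (t * th) < 2) by (apply scaled_lt; [lra|assumption]).
      rewrite !Hclt, Hcl by assumption. unfold clw. rewrite clamp_id; [reflexivity|].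
      left. now apply Hrange. }
    exists (fun t p => Z (t, p)). split; [|split; [|split]].
    + intros z. apply (continuous_ext Z); [now intros []|apply CZ].
    + intros p. rewrite HZ. simpl. rewrite (RInt_ext _ (fun _ => 0)).
      * rewrite RInt_const. unfold scal; simpl; unfold mult; simpl. ring.
      * intros th _. unfold k; simpl. rewrite (Hclt 0) by (rewrite Rabs_R0; lra).
        apply Rmult_0_l.
    + exact Hrange.
    + intros t p Ht Hp.
      apply (is_derive_ext_loc
        (fun t => coord ax3 p + RInt (fun s => G s p (Z (s, p))) 0 t)).
      * generalize (locally_Rabs_lt _ _ Ht). apply filter_imp. intros s Hs.
        symmetry. now apply HZI.
      * eapply is_derive_eq.
        -- apply is_derive_Rplus; [apply is_derive_Rconst|].
           apply (is_derive_RInt_from_0 (fun s => G s p (Z (s, p))) 2 t); auto.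
        -- apply Rplus_0_l.
Qed.

Definition open_flow_domain (p0 : R3) (d rho : R) (s : R) (p : R3) (w : R) : Prop :=
  Rabs s < 2 /\ ball p0 d p /\ Rabs (w - coord ax3 p0) < rho.

Definition continuous_on_flow_domain (p0 : R3) (d rho : R) (G : R -> R3 -> R -> R) : Prop :=
  forall s p w, open_flow_domain p0 d rho s p w ->
    continuous (fun z : R * R3 * R => G (fst (fst z)) (snd (fst z)) (snd z)) (s, p, w).

Definition kron (i k : axis) : R :=
  match i, k with ax1, ax1 | ax2, ax2 | ax3, ax3 => 1 | _, _ => 0 end.

(** Solution of the variational equation along the flow: [Gw] and [Gi] stand for the derivatives of
    the right-hand side in [w] and in the parameter, [c] for the derivative of the initial value. *)
Definition flow_partial (Gw Gi : R -> R3 -> R -> R) (W : R -> R3 -> R) (c t : R) (p : R3) : R :=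
  lin_sol (fun s => Gw s p (W s p)) (fun s => Gi s p (W s p)) c t.

Lemma open_ball_R3 (p0 : R3) (d : R) : open (ball p0 d : R3 -> Prop).
Proof.
  intros p Hp. rewrite ball_R3 in Hp.
  assert (H : forall i, locally p (fun q : R3 => Rabs (coord i q - coord i p0) < d)).
  { intros i.
    assert (C : continuous (coord i) p) by (destruct i; unfold coord; cont).
    exact (C _ (open_Rabs_lt (coord i p0) d _ (Hp i))). }
  generalize (filter_and _ _ (H ax1) (filter_and _ _ (H ax2) (H ax3))).
  apply filter_imp. intros q (H1 & H2 & H3). apply ball_R3. now intros [].
Qed.

Lemma continuous_along_flow (G H : R -> R3 -> R -> R) (W : R -> R3 -> R) (p0 : R3)
  (d rho s : R) (p : R3) :
  is_flow p0 d rho G W -> continuous_on_flow_domain p0 d rho H ->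
  Rabs s < 2 -> ball p0 d p ->
  continuous (fun z : R * R3 => H (fst z) (snd z) (W (fst z) (snd z))) (s, p).
Proof.
  intros (CW & _ & HW & _) CH Hs Hp.
  apply (continuous_comp (fun z : R * R3 => (fst z, snd z, W (fst z) (snd z)))
    (fun z : R * R3 * R => H (fst (fst z)) (snd (fst z)) (snd z))).
  - cont. apply CW.
  - apply CH. split; [|split]; auto.
Qed.

Lemma continuous_flow_partial (G Gw Gi : R -> R3 -> R -> R) (W : R -> R3 -> R) (p0 : R3)
  (d rho c t : R) (p : R3) :
  is_flow p0 d rho G W ->
  continuous_on_flow_domain p0 d rho Gw -> continuous_on_flow_domain p0 d rho Gi ->
  Rabs t < 2 -> ball p0 d p ->
  continuous (fun z : R * R3 => flow_partial Gw Gi W c (fst z) (snd z)) (t, p).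
Proof.
  intros HW Cw Ci Ht Hp.
  apply (continuous_lin_sol (fun s p => Gw s p (W s p)) (fun s p => Gi s p (W s p))
    c 2 t (ball p0 d)); auto.
  - apply open_ball_R3.
  - intros s q Hs Hq. now apply (continuous_along_flow G Gw W p0 d rho).
  - intros s q Hs Hq. now apply (continuous_along_flow G Gi W p0 d rho).
Qed.

Lemma set_coord_id (i : axis) (p : R3) : set_coord i p (coord i p) = p.
Proof. now destruct p as [[x y] z], i. Qed.

Lemma coord_set_coord (i : axis) (p : R3) (e : R) : coord i (set_coord i p e) = e.
Proof. now destruct i. Qed.

Lemma continuous_set_coord {T : UniformSpace} (i : axis) (f : T -> R3) (g : T -> R) (x : T) :
  continuous f x -> continuous g x -> continuous (fun t => set_coord i (f t) (g t)) x.
Proof. intros Hf Hg. destruct i; unfold set_coord; cont. Qed.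

Lemma locally_set_coord (V : R3 -> Prop) (i : axis) (p : R3) :
  open V -> V p -> locally (coord i p) (fun t => V (set_coord i p t)).
Proof.
  intros HV Hp.
  assert (C : continuous (fun t => set_coord i p t) (coord i p)).
  { apply (continuous_set_coord i (fun _ => p) (fun t => t)); cont. }
  apply (C V). rewrite set_coord_id. now apply HV.
Qed.

Lemma ball_set_coord (p0 p : R3) (d : R) (i : axis) :
  ball p0 d p -> exists rho, 0 < rho /\
  forall e, Rabs (e - coord i p) < rho -> ball p0 d (set_coord i p e).
Proof.
  intros Hp.
  assert (H := locally_set_coord _ i p (open_ball_R3 p0 d) Hp). apply locally_Rabs in H.
  destruct H as [rho H]. exists rho. split; [apply cond_pos|exact H].
Qed.

Lemma is_derive_flow_partial (G Gw Gi : R -> R3 -> R -> R) (W : R -> R3 -> R) (p0 : R3)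
  (d rho t : R) (p : R3) (i : axis) :
  is_flow p0 d rho G W ->
  continuous_on_flow_domain p0 d rho Gw -> continuous_on_flow_domain p0 d rho Gi ->
  (forall s p w, open_flow_domain p0 d rho s p w -> is_derive (fun w => G s p w) w (Gw s p w)) ->
  (forall s p w, open_flow_domain p0 d rho s p w ->
     is_derive (fun e => G s (set_coord i p e) w) (coord i p) (Gi s p w)) ->
  Rabs t < 2 -> ball p0 d p ->
  is_derive (fun e => W t (set_coord i p e)) (coord i p) (flow_partial Gw Gi W (kron i ax3) t p).
Proof.
  intros HW Cw Ci Dw Di Ht Hp.
  destruct (ball_set_coord p0 p d i Hp) as (r & Hr & Hball).
  assert (Hflow := HW). destruct HW as (CW & HW0 & HWr & DW).
  assert (Hss : forall e e', set_coord i (set_coord i p e) e' = set_coord i p e').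
  { intros e e'. now destruct i. }
  assert (H := is_derive_flow_param
    (fun s e w => G s (set_coord i p e) w) (fun s e w => Gw s (set_coord i p e) w)
    (fun s e w => Gi s (set_coord i p e) w) (fun s e => W s (set_coord i p e))
    2 (coord i p) r (coord ax3 p0) rho (kron i ax3) t Hr).
  cbv beta in H. rewrite set_coord_id in H. apply H; clear H; auto.
  - intros s e w Hs He Hw. apply Dw. split; [|split]; auto.
  - intros s e w Hs He Hw. assert (D := Di s (set_coord i p e) w).
    rewrite coord_set_coord in D.
    eapply is_derive_ext; [|apply D; split; [|split]; auto].
    intros x. simpl. now rewrite Hss.
  - intros s e w Hs He Hw.
    apply (continuous_comp (fun q : R3 => (fst (fst q), set_coord i p (snd (fst q)), snd q))
      (fun z : R * R3 * R => Gw (fst (fst z)) (snd (fst z)) (snd z))).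
    + cont. apply (continuous_set_coord i (fun _ => p)); cont.
    + apply Cw. split; [|split]; auto.
  - intros s e w Hs He Hw.
    apply (continuous_comp (fun q : R3 => (fst (fst q), set_coord i p (snd (fst q)), snd q))
      (fun z : R * R3 * R => Gi (fst (fst z)) (snd (fst z)) (snd z))).
    + cont. apply (continuous_set_coord i (fun _ => p)); cont.
    + apply Ci. split; [|split]; auto.
  - intros s e Hs He.
    apply (continuous_comp (fun z : R * R => (fst z, set_coord i p (snd z)))
      (fun z : R * R3 => W (fst z) (snd z))); [|apply CW].
    cont. apply (continuous_set_coord i (fun _ => p)); cont.
  - intros e He. rewrite !HW0. destruct i; simpl; ring.
Qed.

(** * Integration along rays *)

Lemma Ck_continuous (n : nat) (V : R3 -> Prop) (f : R3 -> R) (p : R3) :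
  Ck n V f -> V p -> continuous f p.
Proof. destruct n; intros [H _]; apply H. Qed.

Lemma Ck_is_derive (n : nat) (V : R3 -> Prop) (f : R3 -> R) (i : axis) (p : R3) :
  Ck (S n) V f -> V p ->
  is_derive (fun t => f (set_coord i p t)) (coord i p) (partial i f p).
Proof. intros [_ H] Hp. apply Derive_correct. exact (proj1 (H i) p Hp). Qed.

Lemma Ck_partial (n : nat) (V : R3 -> Prop) (f : R3 -> R) (i : axis) :
  Ck (S n) V f -> Ck n V (partial i f).
Proof. intros [_ H]. exact (proj2 (H i)). Qed.

Lemma Ck_S (n : nat) (V : R3 -> Prop) (f : R3 -> R) : Ck (S n) V f -> Ck n V f.
Proof.
  revert f. induction n as [|n IH]; intros f [H1 H2].
  - now split.
  - split; [exact H1|]. intros i. destruct (H2 i) as [H3 H4].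
    split; [exact H3|exact (IH _ H4)].
Qed.

Lemma Ck_subset (n : nat) (V V' : R3 -> Prop) (f : R3 -> R) :
  (forall p, V' p -> V p) -> Ck n V f -> Ck n V' f.
Proof.
  intros HV. revert f. induction n as [|n IH]; intros f [H1 H2].
  - split; [auto|exact I].
  - split; [auto|]. intros i. destruct (H2 i) as [H3 H4].
    split; [auto|exact (IH _ H4)].
Qed.

Lemma partial_ext (V : R3 -> Prop) (f g : R3 -> R) (i : axis) (p : R3) :
  open V -> (forall q, V q -> f q = g q) -> V p -> partial i f p = partial i g p.
Proof.
  intros HV Hfg Hp. apply Derive_ext_loc.
  generalize (locally_set_coord V i p HV Hp). apply filter_imp. auto.
Qed.

Lemma Ck_ext (n : nat) (V : R3 -> Prop) (f g : R3 -> R) :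
  open V -> (forall p, V p -> f p = g p) -> Ck n V f -> Ck n V g.
Proof.
  intros HV. revert f g. induction n as [|n IH]; intros f g Hfg [H1 H2].
  - split; [|exact I]. intros p Hp. apply (continuous_ext_loc _ f); [|auto].
    generalize (HV p Hp). apply filter_imp. auto.
  - split.
    + intros p Hp. apply (continuous_ext_loc _ f); [|auto].
      generalize (HV p Hp). apply filter_imp. auto.
    + intros i. destruct (H2 i) as [H3 H4]. split.
      * intros p Hp. apply (ex_derive_ext_loc (fun t => f (set_coord i p t))); [|exact (H3 p Hp)].
        generalize (locally_set_coord V i p HV Hp). apply filter_imp. auto.
      * apply (IH (partial i f)); [|exact H4].
        intros p Hp. now apply (partial_ext V).
Qed.

Lemma Ck_S_intro (n : nat) (V : R3 -> Prop) (f : R3 -> R) (g : axis -> R3 -> R) :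
  open V -> (forall p, V p -> continuous f p) ->
  (forall i p, V p -> is_derive (fun t => f (set_coord i p t)) (coord i p) (g i p)) ->
  (forall i, Ck n V (g i)) -> Ck (S n) V f.
Proof.
  intros HV Cf Df Cg. split; [exact Cf|]. intros i. split.
  - intros p Hp. exists (g i p). now apply Df.
  - apply (Ck_ext n V (g i)); [exact HV| |apply Cg].
    intros p Hp. symmetry. apply is_derive_unique. now apply Df.
Qed.

Lemma Ck_1_intro (V : R3 -> Prop) (f : R3 -> R) (g : axis -> R3 -> R) :
  open V -> (forall p, V p -> continuous f p) ->
  (forall i p, V p -> is_derive (fun t => f (set_coord i p t)) (coord i p) (g i p)) ->
  (forall i p, V p -> continuous (g i) p) -> Ck 1 V f.
Proof.
  intros HV Cf Df Cg. apply (Ck_S_intro 0 V f g HV Cf Df).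
  intros i. split; [apply Cg|exact I].
Qed.

Lemma is_derive_C1_curve (f : R3 -> R) (D : R3 -> Prop) (a b c : R -> R) (t da db dc : R) :
  open D -> Ck 1 D f -> D (a t, b t, c t) ->
  is_derive a t da -> is_derive b t db -> is_derive c t dc ->
  is_derive (fun s => f (a s, b s, c s)) t
    (da * partial ax1 f (a t, b t, c t) + db * partial ax2 f (a t, b t, c t) +
     dc * partial ax3 f (a t, b t, c t)).
Proof.
  intros HD Hf Hp Ha Hb Hc.
  assert (C : forall i p, D p -> continuous
    (fun q : R3 => partial i f (fst (fst q), snd (fst q), snd q)) p).
  { intros i p H. apply (continuous_ext (partial i f)); [now intros [[x y] z]|].
    apply (Ck_continuous 0 D); [now apply Ck_partial|assumption]. }
  apply (is_derive_comp3 (fun x y z => f (x, y, z)) (fun x y z => partial ax1 f (x, y, z))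
    (fun x y z => partial ax2 f (x, y, z)) (fun x y z => partial ax3 f (x, y, z)) D);
    [exact HD|exact Hp| | | |exact (C _)|exact (C _)|exact (C _)|exact Ha|exact Hb|exact Hc];
    intros x y z H.
  - exact (Ck_is_derive 0 D f ax1 _ Hf H).
  - exact (Ck_is_derive 0 D f ax2 _ Hf H).
  - exact (Ck_is_derive 0 D f ax3 _ Hf H).
Qed.

Lemma Rabs_sub_le_of_derive_le (f g : R -> R) (c r M a b : R) :
  (forall x, Rabs (x - c) <= r -> is_derive f x (g x)) ->
  (forall x, Rabs (x - c) <= r -> Rabs (g x) <= M) ->
  Rabs (a - c) <= r -> Rabs (b - c) <= r ->
  Rabs (f a - f b) <= M * Rabs (a - b).
Proof.
  intros Hf Hg Ha Hb.
  assert (Hbt : forall x, Rmin b a <= x <= Rmax b a -> Rabs (x - c) <= r).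
  { intros x. unfold Rmin, Rmax, Rabs in *.
    repeat destruct Rle_dec; repeat destruct Rcase_abs; lra. }
  destruct (MVT_gen f b a g) as (x & Hx & ->).
  - intros x Hx. apply Hf, Hbt. lra.
  - intros x Hx. apply continuity_pt_filterlim.
    apply (is_derive_continuous f x (g x)). now apply Hf, Hbt.
  - rewrite Rabs_mult. apply Rmult_le_compat_r; [apply Rabs_pos|].
    now apply Hg, Hbt.
Qed.

Lemma is_derive_coord_set_coord (i k : axis) (p : R3) (t : R) :
  is_derive (fun e => coord k (set_coord i p e)) t (kron i k).
Proof.
  destruct i, k; simpl; first [apply is_derive_Rid | apply is_derive_Rconst].
Qed.

(* The point at time [s] above the segment that joins the first two coordinates
   of [p] (at [s = 0]) to those of [p0] (at [s = 1]). *)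
Definition ray (p0 : R3) (s : R) (p : R3) (w : R) : R3 :=
  (coord ax1 p0 + (1 - s) * (coord ax1 p - coord ax1 p0),
   coord ax2 p0 + (1 - s) * (coord ax2 p - coord ax2 p0), w).

Lemma ray_0 (p0 p : R3) : ray p0 0 p (coord ax3 p) = p.
Proof.
  destruct p as [[x y] z]. unfold ray; simpl. f_equal. f_equal; ring.
Qed.

Lemma continuous_ray_comp {T : UniformSpace} (p0 : R3) (F : R3 -> R) (s : T -> R)
  (p : T -> R3) (w : T -> R) (x : T) :
  continuous F (ray p0 (s x) (p x) (w x)) ->
  continuous s x -> continuous p x -> continuous w x ->
  continuous (fun t => F (ray p0 (s t) (p t) (w t))) x.
Proof.
  intros HF Hs Hp Hw.
  apply (continuous_comp (fun t => ray p0 (s t) (p t) (w t)) F); [|exact HF].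
  unfold ray, coord. cont.
Qed.

(** Taken at [A] and [B] this is the right-hand side of the ODE; taken at their third partial
    derivatives it is the derivative of that right-hand side in [w]. *)
Definition along_ray (p0 : R3) (F1 F2 : R3 -> R) (s : R) (p : R3) (w : R) : R :=
  - ((coord ax1 p - coord ax1 p0) * F1 (ray p0 s p w) +
     (coord ax2 p - coord ax2 p0) * F2 (ray p0 s p w)).

(** [dw] is the derivative of the height [w] along axis [i]: 0 for the explicit dependence on [p],
    the derivative of the flow for the total one. *)
Definition ray_partial (p0 : R3) (i : axis) (F : R3 -> R) (s : R) (p : R3) (w dw : R) : R :=
  (1 - s) * kron i ax1 * partial ax1 F (ray p0 s p w) +
  (1 - s) * kron i ax2 * partial ax2 F (ray p0 s p w) +
  dw * partial ax3 F (ray p0 s p w).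

Definition along_ray_partial (p0 : R3) (i : axis) (F1 F2 : R3 -> R) (s : R) (p : R3)
  (w dw : R) : R :=
  - (kron i ax1 * F1 (ray p0 s p w) +
     (coord ax1 p - coord ax1 p0) * ray_partial p0 i F1 s p w dw +
     (kron i ax2 * F2 (ray p0 s p w) +
      (coord ax2 p - coord ax2 p0) * ray_partial p0 i F2 s p w dw)).

Section Ray.

Context (p0 : R3) (V : R3 -> Prop).
Hypothesis HV : open V.

Lemma is_derive_ray (F : R3 -> R) (i : axis) (s : R) (p : R3) (w : R -> R) (dw : R) :
  Ck 1 V F -> V (ray p0 s p (w (coord i p))) ->
  is_derive w (coord i p) dw ->
  is_derive (fun e => F (ray p0 s (set_coord i p e) (w e))) (coord i p)
    (ray_partial p0 i F s p (w (coord i p)) dw).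
Proof.
  intros HF Hp Hw.
  assert (Hk : forall k, is_derive
    (fun e => coord k p0 + (1 - s) * (coord k (set_coord i p e) - coord k p0))
    (coord i p) ((1 - s) * kron i k)).
  { intros k. eapply is_derive_eq.
    - apply is_derive_Rplus; [apply is_derive_Rconst|].
      apply is_derive_Rmult; [apply is_derive_Rconst|].
      apply is_derive_Rminus; [apply is_derive_coord_set_coord|apply is_derive_Rconst].
    - cbv beta. ring. }
  assert (H := is_derive_C1_curve F V
    (fun e => coord ax1 p0 + (1 - s) * (coord ax1 (set_coord i p e) - coord ax1 p0))
    (fun e => coord ax2 p0 + (1 - s) * (coord ax2 (set_coord i p e) - coord ax2 p0))
    w (coord i p) ((1 - s) * kron i ax1) ((1 - s) * kron i ax2) dw HV HF).
  cbv beta in H. rewrite set_coord_id in H.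
  exact (H Hp (Hk ax1) (Hk ax2) Hw).
Qed.

Lemma is_derive_along_ray (F1 F2 : R3 -> R) (i : axis) (s : R) (p : R3) (w : R -> R) (dw : R) :
  Ck 1 V F1 -> Ck 1 V F2 -> V (ray p0 s p (w (coord i p))) ->
  is_derive w (coord i p) dw ->
  is_derive (fun e => along_ray p0 F1 F2 s (set_coord i p e) (w e)) (coord i p)
    (along_ray_partial p0 i F1 F2 s p (w (coord i p)) dw).
Proof.
  intros H1 H2 Hp Hw. unfold along_ray. eapply is_derive_eq.
  - apply is_derive_Ropp, is_derive_Rplus; apply is_derive_Rmult.
    + apply is_derive_Rminus; [apply is_derive_coord_set_coord|apply is_derive_Rconst].
    + apply (is_derive_ray F1 i s p w dw); assumption.
    + apply is_derive_Rminus; [apply is_derive_coord_set_coord|apply is_derive_Rconst].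
    + apply (is_derive_ray F2 i s p w dw); assumption.
  - cbv beta. rewrite set_coord_id. unfold along_ray_partial. ring.
Qed.

Lemma is_derive_along_ray_last (F1 F2 : R3 -> R) (s : R) (p : R3) (w : R) :
  Ck 1 V F1 -> Ck 1 V F2 -> V (ray p0 s p w) ->
  is_derive (fun w => along_ray p0 F1 F2 s p w) w
    (along_ray p0 (partial ax3 F1) (partial ax3 F2) s p w).
Proof.
  intros H1 H2 Hp. unfold along_ray. eapply is_derive_eq.
  - apply is_derive_Ropp, is_derive_Rplus; apply is_derive_Rmult.
    + apply is_derive_Rconst.
    + exact (Ck_is_derive 0 V F1 ax3 _ H1 Hp).
    + apply is_derive_Rconst.
    + exact (Ck_is_derive 0 V F2 ax3 _ H2 Hp).
  - cbv beta. ring.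
Qed.

Lemma continuous_along_ray {T : UniformSpace} (F1 F2 : R3 -> R) (s : T -> R) (p : T -> R3)
  (w : T -> R) (x : T) :
  Ck 0 V F1 -> Ck 0 V F2 -> V (ray p0 (s x) (p x) (w x)) ->
  continuous s x -> continuous p x -> continuous w x ->
  continuous (fun t => along_ray p0 F1 F2 (s t) (p t) (w t)) x.
Proof.
  intros H1 H2 Hp Cs Cp Cw. unfold along_ray, coord.
  assert (C1 := continuous_ray_comp p0 F1 s p w x (Ck_continuous 0 V F1 _ H1 Hp) Cs Cp Cw).
  assert (C2 := continuous_ray_comp p0 F2 s p w x (Ck_continuous 0 V F2 _ H2 Hp) Cs Cp Cw).
  cont.
Qed.

Lemma continuous_along_ray_partial {T : UniformSpace} (F1 F2 : R3 -> R) (i : axis)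
  (s : T -> R) (p : T -> R3) (w dw : T -> R) (x : T) :
  Ck 1 V F1 -> Ck 1 V F2 -> V (ray p0 (s x) (p x) (w x)) ->
  continuous s x -> continuous p x -> continuous w x -> continuous dw x ->
  continuous (fun t => along_ray_partial p0 i F1 F2 (s t) (p t) (w t) (dw t)) x.
Proof.
  intros H1 H2 Hp Cs Cp Cw Cdw. unfold along_ray_partial, ray_partial, coord.
  assert (C : forall F, Ck 0 V F -> continuous (fun t => F (ray p0 (s t) (p t) (w t))) x).
  { intros F HF. apply continuous_ray_comp; auto. now apply (Ck_continuous 0 V). }
  assert (D1 := C _ (Ck_S _ _ _ H1)). assert (D2 := C _ (Ck_S _ _ _ H2)).
  assert (D11 := C _ (Ck_partial _ _ _ ax1 H1)). assert (D12 := C _ (Ck_partial _ _ _ ax2 H1)).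
  assert (D13 := C _ (Ck_partial _ _ _ ax3 H1)). assert (D21 := C _ (Ck_partial _ _ _ ax1 H2)).
  assert (D22 := C _ (Ck_partial _ _ _ ax2 H2)). assert (D23 := C _ (Ck_partial _ _ _ ax3 H2)).
  cont.
Qed.

End Ray.

(** * The Frobenius theorem *)

(** The gradient of [u] is [K] times the normal [(- A, - B, 1)] of the plane field. [K] is named
    separately in order to record that it is C^1. *)
Definition first_integral (A B : R3 -> R) (V : R3 -> Prop) (u K : R3 -> R) : Prop :=
  Ck 1 V u /\ Ck 1 V K /\ (forall p, V p -> 0 < K p) /\
  (forall p, V p -> partial ax1 u p = - A p * K p) /\
  (forall p, V p -> partial ax2 u p = - B p * K p) /\
  (forall p, V p -> partial ax3 u p = K p).

Section Frobenius.

Context (A B : R3 -> R) (p0 : R3) (r d M : R).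
Let V : R3 -> Prop := ball p0 r.
Hypothesis CA : Ck 2 V A.
Hypothesis CB : Ck 2 V B.
Hypothesis bound_A : forall p, V p -> Rabs (A p) <= M.
Hypothesis bound_B : forall p, V p -> Rabs (B p) <= M.
Hypothesis bound_A3 : forall p, V p -> Rabs (partial ax3 A p) <= M.
Hypothesis bound_B3 : forall p, V p -> Rabs (partial ax3 B p) <= M.
Hypothesis d_pos : 0 < d.
Hypothesis M_pos : 0 <= M.
(** The 3 bounds [Rabs (1 - s)] for [Rabs s <= 2], which keeps rays inside [V]. The other two
    conditions are those of [ex_flow], because [2 * d * M] bounds both [G] and its Lipschitz
    constant in [w]. *)
Hypothesis d_small_r : 3 * d < r.
Hypothesis d_small_M : d + 2 * (2 * d * M) <= r / 2.
Hypothesis d_small_lip : 2 * d * M <= / 4.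
(** The fields [d/dx + A d/dz] and [d/dy + B d/dz] commute. *)
Hypothesis integrable : forall p, V p ->
  partial ax2 A p + B p * partial ax3 A p = partial ax1 B p + A p * partial ax3 B p.

Let G := along_ray p0 A B.
Let Gw := along_ray p0 (partial ax3 A) (partial ax3 B).
Let Gi (i : axis) s p w := along_ray_partial p0 i A B s p w 0.

Let open_V : open V := open_ball_R3 p0 r.
Let CA1 : Ck 1 V A := Ck_S _ _ _ CA.
Let CB1 : Ck 1 V B := Ck_S _ _ _ CB.
Let CA3 : Ck 1 V (partial ax3 A) := Ck_partial _ _ _ ax3 CA.
Let CB3 : Ck 1 V (partial ax3 B) := Ck_partial _ _ _ ax3 CB.

Let ray_in_V (s : R) (p : R3) (w : R) : flow_domain p0 d (r / 2) s p w -> V (ray p0 s p w).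
Proof.
  intros (Hs & Hp & Hw). apply ball_R3.
  assert (H : forall x, Rabs x <= d -> Rabs ((1 - s) * x) < r).
  { intros x Hx. rewrite Rabs_mult.
    assert (H1 : Rabs (1 - s) <= 3) by (unfold Rabs in *; repeat destruct Rcase_abs; lra).
    assert (H2 := Rmult_le_compat _ _ _ _ (Rabs_pos (1 - s)) (Rabs_pos x) H1 Hx). lra. }
  intros []; simpl.
  - rewrite Rplus_minus_l. apply H, (Hp ax1).
  - rewrite Rplus_minus_l. apply H, (Hp ax2).
  - simpl in Hw. lra.
Qed.

Let open_flow_domain_V (s : R) (p : R3) (w : R) :
  open_flow_domain p0 d (r / 2) s p w -> V (ray p0 s p w).
Proof.
  intros (Hs & Hp & Hw). apply ray_in_V. split; [lra|split; [|lra]].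
  intros i. left. now apply ball_R3.
Qed.

(** Stated for differences so that it yields both the bound on [G], against the value 0, and its
    Lipschitz constant. *)
Let along_ray_bound (F1 F2 F1' F2' : R) (N : R) (p : R3) :
  (forall i, Rabs (coord i p - coord i p0) <= d) ->
  Rabs (F1 - F1') <= N -> Rabs (F2 - F2') <= N ->
  Rabs (- ((coord ax1 p - coord ax1 p0) * F1 + (coord ax2 p - coord ax2 p0) * F2) -
        - ((coord ax1 p - coord ax1 p0) * F1' + (coord ax2 p - coord ax2 p0) * F2'))
    <= 2 * d * N.
Proof.
  intros Hp H1 H2. rewrite <- Rabs_Ropp.
  match goal with |- Rabs ?x <= _ => replace x with
    ((coord ax1 p - coord ax1 p0) * (F1 - F1') + (coord ax2 p - coord ax2 p0) * (F2 - F2'))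
    by ring end.
  eapply Rle_trans; [apply Rabs_triang|]. rewrite !Rabs_mult.
  assert (E1 := Rmult_le_compat _ _ _ _ (Rabs_pos _) (Rabs_pos _) (Hp ax1) H1).
  assert (E2 := Rmult_le_compat _ _ _ _ (Rabs_pos _) (Rabs_pos _) (Hp ax2) H2).
  lra.
Qed.

Lemma ex_ray_flow : exists W, is_flow p0 d (r / 2) G W.
Proof.
  apply ex_flow with (M := 2 * d * M).
  - exact d_pos.
  - apply Rmult_le_pos; lra.
  - intros s p w H.
    apply (continuous_along_ray p0 V A B (fun z : R * R3 * R => fst (fst z))
      (fun z : R * R3 * R => snd (fst z)) snd); [now apply Ck_S|now apply Ck_S| | | | ]; cont.
    now apply ray_in_V.
  - intros s p w H. rewrite <- (Rminus_0_r (G s p w)).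
    replace 0 with (- ((coord ax1 p - coord ax1 p0) * 0 + (coord ax2 p - coord ax2 p0) * 0))
      by ring.
    apply along_ray_bound; [apply H| |]; rewrite Rminus_0_r;
      [apply bound_A|apply bound_B]; now apply ray_in_V.
  - intros s p w w' H H'.
    assert (L : forall F, Ck 1 V F -> (forall p, V p -> Rabs (partial ax3 F p) <= M) ->
              Rabs (F (ray p0 s p w) - F (ray p0 s p w')) <= M * Rabs (w - w')).
    { intros F CF HF.
      destruct H as (Hs & Hp & Hw). destruct H' as (_ & _ & Hw').
      apply (Rabs_sub_le_of_derive_le (fun w => F (ray p0 s p w))
        (fun w => partial ax3 F (ray p0 s p w)) (coord ax3 p0) (r / 2)); [| |exact Hw|exact Hw'].
      - intros x Hx. assert (HV : V (ray p0 s p x)) by now apply ray_in_V.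
        exact (Ck_is_derive 0 V F ax3 _ CF HV).
      - intros x Hx. apply HF. now apply ray_in_V. }
    eapply Rle_trans.
    + apply along_ray_bound; [apply H|apply (L A CA1 bound_A3)|apply (L B CB1 bound_B3)].
    + assert (E := Rmult_le_compat_r _ _ _ (Rabs_pos (w - w')) d_small_lip). lra.
  - exact d_small_M.
Qed.

Let Cflow_Gw : continuous_on_flow_domain p0 d (r / 2) Gw.
Proof.
  intros s p w H.
  apply (continuous_along_ray p0 V (partial ax3 A) (partial ax3 B)
    (fun z : R * R3 * R => fst (fst z))
    (fun z : R * R3 * R => snd (fst z)) snd); [now apply Ck_S|now apply Ck_S| | | | ]; cont.
  now apply open_flow_domain_V.
Qed.

Let Cflow_Gi (i : axis) : continuous_on_flow_domain p0 d (r / 2) (Gi i).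
Proof.
  intros s p w H.
  apply (continuous_along_ray_partial p0 V A B i (fun z : R * R3 * R => fst (fst z))
    (fun z : R * R3 * R => snd (fst z)) snd (fun _ => 0)); [exact CA1|exact CB1| | | | | ]; cont.
  now apply open_flow_domain_V.
Qed.

Section Flow.

Context (W : R -> R3 -> R).
Hypothesis HW : is_flow p0 d (r / 2) G W.

Let VW (i : axis) (t : R) (p : R3) : R := flow_partial Gw (Gi i) W (kron i ax3) t p.

Let ray_W_in_V (t : R) (p : R3) : Rabs t < 2 -> ball p0 d p -> V (ray p0 t p (W t p)).
Proof.
  intros Ht Hp. apply open_flow_domain_V. split; [|split]; auto. now apply HW.
Qed.

Let is_derive_W (i : axis) (t : R) (p : R3) : Rabs t < 2 -> ball p0 d p ->
  is_derive (fun e => W t (set_coord i p e)) (coord i p) (VW i t p).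
Proof.
  intros Ht Hp.
  apply (is_derive_flow_partial G Gw (Gi i) W p0 d (r / 2) t p i HW Cflow_Gw (Cflow_Gi i));
    [| |exact Ht|exact Hp].
  - intros s q w H. apply (is_derive_along_ray_last p0 V A B s q w CA1 CB1).
    now apply open_flow_domain_V.
  - intros s q w H.
    apply (is_derive_along_ray p0 V open_V A B i s q (fun _ => w) 0 CA1 CB1).
    + now apply open_flow_domain_V.
    + apply is_derive_Rconst.
Qed.

Let continuous_VW (i : axis) (t : R) (p : R3) : Rabs t < 2 -> ball p0 d p ->
  continuous (fun z : R * R3 => VW i (fst z) (snd z)) (t, p).
Proof.
  intros Ht Hp.
  exact (continuous_flow_partial G Gw (Gi i) W p0 d (r / 2) _ t p HW Cflow_Gw (Cflow_Gi i) Ht Hp).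
Qed.

Let rate (s : R) (p : R3) : R := Gw s p (W s p).

Let continuous_in_time (H : R -> R3 -> R -> R) (p : R3) :
  continuous_on_flow_domain p0 d (r / 2) H -> ball p0 d p ->
  forall s, Rabs s < 2 -> continuous (fun s => H s p (W s p)) s.
Proof.
  intros CH Hp s Hs. apply (continuous_section (fun s p => H s p (W s p))).
  exact (continuous_along_flow G H W p0 d (r / 2) s p HW CH Hs Hp).
Qed.

Let is_derive_VW_time (i : axis) (t : R) (p : R3) : Rabs t < 2 -> ball p0 d p ->
  is_derive (fun t => VW i t p) t (rate t p * VW i t p + Gi i t p (W t p)).
Proof.
  intros Ht Hp.
  exact (is_derive_lin_sol (fun s => Gw s p (W s p)) (fun s => Gi i s p (W s p)) 2
    (continuous_in_time Gw p Cflow_Gw Hp) (continuous_in_time (Gi i) p (Cflow_Gi i) Hp)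
    (kron i ax3) t Ht).
Qed.

Let Gi_3 (t : R) (p : R3) (w : R) : Gi ax3 t p w = 0.
Proof. unfold Gi, along_ray_partial, ray_partial. simpl. ring. Qed.

(** [G] sees [p] only through its first two coordinates, so the variational equation along the third
    axis is homogeneous with initial value 1. This explicit form is what will be differentiated once
    more. *)
Let VW_3 (t : R) (p : R3) : VW ax3 t p = exp (RInt (fun s => rate s p) 0 t).
Proof.
  unfold VW, flow_partial, lin_sol.
  rewrite (RInt_ext (fun s => Gi ax3 s p (W s p) * exp (- RInt (fun s => Gw s p (W s p)) 0 s))
    (fun _ => 0)).
  - rewrite RInt_const. unfold scal; simpl; unfold mult; simpl. unfold rate. ring.
  - intros s _. rewrite Gi_3. apply Rmult_0_l.
Qed.

Let is_derive_along_leaf (F : R3 -> R) (t : R) (p : R3) :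
  Ck 1 V F -> Rabs t < 2 -> ball p0 d p ->
  is_derive (fun t => F (ray p0 t p (W t p))) t
    (- (coord ax1 p - coord ax1 p0) * partial ax1 F (ray p0 t p (W t p)) +
     - (coord ax2 p - coord ax2 p0) * partial ax2 F (ray p0 t p (W t p)) +
     G t p (W t p) * partial ax3 F (ray p0 t p (W t p))).
Proof.
  intros CF Ht Hp.
  assert (D : forall k, is_derive
    (fun s => coord k p0 + (1 - s) * (coord k p - coord k p0)) t (- (coord k p - coord k p0))).
  { intros k. eapply is_derive_eq.
    - apply is_derive_Rplus; [apply is_derive_Rconst|].
      apply is_derive_Rmult; [|apply is_derive_Rconst].
      apply is_derive_Rminus; [apply is_derive_Rconst|apply is_derive_Rid].
    - cbv beta. ring. }
  apply (is_derive_C1_curve F V (fun s => coord ax1 p0 + (1 - s) * (coord ax1 p - coord ax1 p0))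
    (fun s => coord ax2 p0 + (1 - s) * (coord ax2 p - coord ax2 p0)) (fun t => W t p) t
    _ _ _ open_V CF).
  - exact (ray_W_in_V t p Ht Hp).
  - exact (D ax1).
  - exact (D ax2).
  - now apply HW.
Qed.

(* The derivatives of the flow along the leaf directions [(1, 0, A)] and
   [(0, 1, B)], corrected by the motion of the end point, solve the homogeneous
   linear ODE: this is where integrability enters. *)
Let leaf_invariance (i : axis) (F : R3 -> R) (p : R3) :
  Ck 1 V F -> kron i ax3 = 0 -> ball p0 d p ->
  (forall t, Rabs t < 2 ->
     Gi i t p (W t p) + F (ray p0 t p (W t p)) -
     (1 - t) * (- (coord ax1 p - coord ax1 p0) * partial ax1 F (ray p0 t p (W t p)) +
       - (coord ax2 p - coord ax2 p0) * partial ax2 F (ray p0 t p (W t p)) +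
       G t p (W t p) * partial ax3 F (ray p0 t p (W t p))) =
     - rate t p * ((1 - t) * F (ray p0 t p (W t p)))) ->
  VW i 1 p = - F p * VW ax3 1 p.
Proof.
  intros CF Hi Hp Hid.
  (* At time 0 this combination is [F p - F p]; at time 1 its last term has the factor [1 - 1], and
     what is left is the claim. *)
  assert (H := linear_ODE_unique (fun s => rate s p) (fun _ => 0) 2
    (continuous_in_time Gw p Cflow_Gw Hp) (fun s _ => continuous_const 0 s)
    (fun t => VW i t p + F p * VW ax3 t p - (1 - t) * F (ray p0 t p (W t p))) 0 0).
  assert (H1 : Rabs 1 < 2) by (rewrite Rabs_R1; lra).
  cbv beta in H.
  assert (E : VW i 1 p + F p * VW ax3 1 p - (1 - 1) * F (ray p0 1 p (W 1 p)) =
    0 * lin_sol (fun s => rate s p) (fun _ => 0) 0 1); [apply H; [| |exact H1]|lra].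
  - intros s Hs. eapply is_derive_eq.
    + apply is_derive_Rminus; [apply is_derive_Rplus|].
      * exact (is_derive_VW_time i s p Hs Hp).
      * apply is_derive_Rmult; [apply is_derive_Rconst|exact (is_derive_VW_time ax3 s p Hs Hp)].
      * apply is_derive_Rmult; [apply is_derive_Rminus;
          [apply is_derive_Rconst|apply is_derive_Rid]|].
        exact (is_derive_along_leaf F s p CF Hs Hp).
    + cbv beta. specialize (Hid s Hs). rewrite Gi_3. lra.
  - unfold VW, flow_partial. rewrite !lin_sol_0, Hi. simpl kron.
    destruct HW as (_ & HW0 & _). rewrite HW0, ray_0. ring.
Qed.

Let VW_1 (p : R3) : ball p0 d p -> VW ax1 1 p = - A p * VW ax3 1 p.
Proof.
  intros Hp. apply (leaf_invariance ax1 A p CA1 eq_refl Hp).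
  intros t Ht. assert (I := integrable _ (ray_W_in_V t p Ht Hp)).
  unfold rate, Gw, G, Gi, along_ray, along_ray_partial, ray_partial. simpl kron.
  (* The terms in [x - x0] cancel by themselves; the coefficient of [y - y0] is the integrability
     condition. *)
  replace (partial ax2 A (ray p0 t p (W t p))) with
    (partial ax1 B (ray p0 t p (W t p)) +
     A (ray p0 t p (W t p)) * partial ax3 B (ray p0 t p (W t p)) -
     B (ray p0 t p (W t p)) * partial ax3 A (ray p0 t p (W t p))) by lra.
  ring.
Qed.

Let VW_2 (p : R3) : ball p0 d p -> VW ax2 1 p = - B p * VW ax3 1 p.
Proof.
  intros Hp. apply (leaf_invariance ax2 B p CB1 eq_refl Hp).
  intros t Ht. assert (I := integrable _ (ray_W_in_V t p Ht Hp)).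
  unfold rate, Gw, G, Gi, along_ray, along_ray_partial, ray_partial. simpl kron.
  replace (partial ax1 B (ray p0 t p (W t p))) with
    (partial ax2 A (ray p0 t p (W t p)) +
     B (ray p0 t p (W t p)) * partial ax3 A (ray p0 t p (W t p)) -
     A (ray p0 t p (W t p)) * partial ax3 B (ray p0 t p (W t p))) by lra.
  ring.
Qed.

(** The total derivative of [rate], including the motion of [W]. It involves second derivatives of
    [A] and [B], which is where their C^2 regularity is spent. *)
Let rate_partial (i : axis) (s : R) (p : R3) : R :=
  along_ray_partial p0 i (partial ax3 A) (partial ax3 B) s p (W s p) (VW i s p).

Let is_derive_rate (i : axis) (s : R) (p : R3) : Rabs s < 2 -> ball p0 d p ->
  is_derive (fun e => rate s (set_coord i p e)) (coord i p) (rate_partial i s p).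
Proof.
  intros Hs Hp. unfold rate, rate_partial.
  assert (H := is_derive_along_ray p0 V open_V (partial ax3 A) (partial ax3 B) i s p
    (fun e => W s (set_coord i p e)) (VW i s p) CA3 CB3).
  cbv beta in H. rewrite set_coord_id in H. apply H.
  - exact (ray_W_in_V s p Hs Hp).
  - exact (is_derive_W i s p Hs Hp).
Qed.

Let continuous_rate (s : R) (p : R3) : Rabs s < 2 -> ball p0 d p ->
  continuous (fun z : R * R3 => rate (fst z) (snd z)) (s, p).
Proof.
  intros Hs Hp. exact (continuous_along_flow G Gw W p0 d (r / 2) s p HW Cflow_Gw Hs Hp).
Qed.

Let continuous_rate_partial (i : axis) (s : R) (p : R3) : Rabs s < 2 -> ball p0 d p ->
  continuous (fun z : R * R3 => rate_partial i (fst z) (snd z)) (s, p).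
Proof.
  intros Hs Hp.
  apply (continuous_along_ray_partial p0 V (partial ax3 A) (partial ax3 B) i fst snd
    (fun z : R * R3 => W (fst z) (snd z)) (fun z : R * R3 => VW i (fst z) (snd z))
    (s, p) CA3 CB3).
  - exact (ray_W_in_V s p Hs Hp).
  - cont.
  - cont.
  - apply HW.
  - exact (continuous_VW i s p Hs Hp).
Qed.

Let is_derive_RInt_rate (i : axis) (p : R3) : ball p0 d p ->
  is_derive (fun e => RInt (fun s => rate s (set_coord i p e)) 0 1) (coord i p)
    (RInt (fun s => rate_partial i s p) 0 1).
Proof.
  intros Hp. destruct (ball_set_coord p0 p d i Hp) as (eps & Heps & Hball).
  set (D := fun e => Rabs (e - coord i p) < eps).
  assert (HD : locally (coord i p) D).
  { apply (open_Rabs_lt (coord i p) eps). now rewrite Rminus_diag, Rabs_R0. }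
  assert (Hde : forall s e, Rabs s < 2 -> D e ->
            is_derive (fun e => rate s (set_coord i p e)) e (rate_partial i s (set_coord i p e))).
  { intros s e Hs He. assert (H := is_derive_rate i s _ Hs (Hball e He)).
    rewrite coord_set_coord in H.
    revert H. apply is_derive_ext. intros x. now destruct i. }
  assert (H01 : forall s, 0 <= s <= 1 -> Rabs s < 2).
  { intros s Hs. rewrite Rabs_pos_eq; lra. }
  eapply is_derive_eq.
  - apply (is_derive_RInt_param (fun e s => rate s (set_coord i p e)));
      rewrite ?Rmin_left, ?Rmax_right by lra.
    + revert HD. apply filter_imp. intros e He s Hs. eexists. apply Hde; auto.
    + intros s Hs. apply continuity_2d_pt_filterlim.
      (* The pair here is (parameter, time), the reverse of the order in [rate_partial], and the
         [Derive] is identified with [rate_partial] only near the point. *)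
      change (continuous (fun z : R * R =>
        Derive (fun e => rate (snd z) (set_coord i p e)) (fst z)) (coord i p, s)).
      apply (continuous_ext_loc _
        (fun z : R * R => rate_partial i (snd z) (set_coord i p (fst z)))).
      * assert (L : locally (coord i p, s) (fun z : R * R => D (fst z) /\ Rabs (snd z) < 2)).
        { apply filter_and.
          - exact (continuous_fst (coord i p) s D HD).
          - exact (continuous_snd (coord i p) s (fun s => Rabs s < 2)
              (locally_Rabs_lt 2 s (H01 s Hs))). }
        revert L. apply filter_imp. intros [e s'] [He Hs']; simpl in *.
        symmetry. apply is_derive_unique. now apply Hde.
      * apply (continuous_comp (fun z : R * R => (snd z, set_coord i p (fst z)))
          (fun z : R * R3 => rate_partial i (fst z) (snd z))).
        -- cont. apply (continuous_set_coord i (fun _ => p)); cont.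
        -- simpl. rewrite set_coord_id. apply continuous_rate_partial; auto.
    + revert HD. apply filter_imp. intros e He.
      apply (ex_RInt_from_0 (fun s => rate s (set_coord i p e)) 2);
        [|apply H01; lra].
      intros s Hs. apply (continuous_section rate). apply continuous_rate; auto.
  - apply RInt_ext. rewrite Rmin_left, Rmax_right by lra. intros s Hs.
    assert (Hs2 : Rabs s < 2) by (apply H01; lra).
    assert (H := is_derive_rate i s p Hs2 Hp). now apply is_derive_unique.
Qed.

Let continuous_RInt_01 (f : R -> R3 -> R) (p : R3) :
  (forall s q, Rabs s < 2 -> ball p0 d q ->
     continuous (fun z : R * R3 => f (fst z) (snd z)) (s, q)) ->
  ball p0 d p -> continuous (fun p => RInt (fun s => f s p) 0 1) p.
Proof.
  intros Cf Hp.
  apply (continuous_comp (fun p => (1, p))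
    (fun z : R * R3 => RInt (fun s => f s (snd z)) 0 (fst z))); [cont|].
  apply (continuous_RInt_param_from_0 f (ball p0 d) 2); auto.
  - apply open_ball_R3.
  - rewrite Rabs_R1. lra.
Qed.

Lemma first_integral_of_flow :
  first_integral A B (ball p0 d) (W 1) (fun p => exp (RInt (fun s => rate s p) 0 1)).
Proof.
  assert (H1 : Rabs 1 < 2) by (rewrite Rabs_R1; lra).
  assert (D : forall i p, ball p0 d p -> partial i (W 1) p = VW i 1 p).
  { intros i p Hp. apply is_derive_unique. exact (is_derive_W i 1 p H1 Hp). }
  split; [|split; [|split; [|split; [|split]]]].
  - apply (Ck_1_intro _ _ (fun i p => VW i 1 p)).
    + apply open_ball_R3.
    + intros p Hp. apply (continuous_comp (fun p => (1, p))
        (fun z : R * R3 => W (fst z) (snd z))); [cont|apply HW].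
    + intros i p Hp. exact (is_derive_W i 1 p H1 Hp).
    + intros i p Hp. apply (continuous_comp (fun p => (1, p))
        (fun z : R * R3 => VW i (fst z) (snd z))); [cont|exact (continuous_VW i 1 p H1 Hp)].
  - assert (CI : forall p, ball p0 d p -> continuous (fun p => RInt (fun s => rate s p) 0 1) p).
    { intros p Hp. exact (continuous_RInt_01 rate p continuous_rate Hp). }
    apply (Ck_1_intro _ _ (fun i p =>
      RInt (fun s => rate_partial i s p) 0 1 * exp (RInt (fun s => rate s p) 0 1))).
    + apply open_ball_R3.
    + intros p Hp. assert (C := CI p Hp). cont.
    + intros i p Hp. eapply is_derive_eq.
      * apply is_derive_Rexp. exact (is_derive_RInt_rate i p Hp).
      * cbv beta. now rewrite set_coord_id.
    + intros i p Hp. assert (C := CI p Hp).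
      assert (C' := continuous_RInt_01 (rate_partial i) p (continuous_rate_partial i) Hp).
      cont.
  - intros p Hp. apply exp_pos.
  - intros p Hp. now rewrite D, VW_1, VW_3.
  - intros p Hp. now rewrite D, VW_2, VW_3.
  - intros p Hp. now rewrite D, VW_3.
Qed.

End Flow.

Lemma ex_first_integral_of_bounds : exists u K, first_integral A B (ball p0 d) u K.
Proof.
  destruct ex_ray_flow as [W HW]. eexists. eexists. exact (first_integral_of_flow W HW).
Qed.

End Frobenius.

Lemma locally_bounded (F : R3 -> R) (p0 : R3) :
  continuous F p0 -> locally p0 (fun p => Rabs (F p) <= Rabs (F p0) + 1).
Proof.
  intros HF. generalize (proj1 (continuous_Rabs_lt _ _) HF (mkposreal 1 Rlt_0_1)).
  apply filter_imp. simpl. intros p Hp.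
  replace (F p) with ((F p - F p0) + F p0) by ring.
  eapply Rle_trans; [apply Rabs_triang|lra].
Qed.

Lemma ex_first_integral (A B : R3 -> R) (p0 : R3) (V : R3 -> Prop) :
  open V -> V p0 -> Ck 2 V A -> Ck 2 V B ->
  (forall p, V p ->
     partial ax2 A p + B p * partial ax3 A p = partial ax1 B p + A p * partial ax3 B p) ->
  exists d : posreal, exists u K, (forall p, ball p0 d p -> V p) /\
    first_integral A B (ball p0 d) u K.
Proof.
  intros HV Hp0 CA CB Hint.
  assert (C : forall F, Ck 1 V F -> continuous F p0).
  { intros F HF. exact (Ck_continuous 1 V F p0 HF Hp0). }
  assert (C0 : forall F, Ck 2 V F -> continuous (partial ax3 F) p0).
  { intros F HF. exact (C _ (Ck_partial _ _ _ ax3 HF)). }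
  set (N := fun F : R3 -> R => Rabs (F p0) + 1).
  (* A sum rather than a maximum: it dominates all four local bounds, and since each [N] is at least
     1 it gives [4 <= M]. *)
  set (M := N A + N B + N (partial ax3 A) + N (partial ax3 B)).
  assert (HN : forall F, 1 <= N F).
  { intros F. unfold N. assert (H := Rabs_pos (F p0)). lra. }
  assert (NA := HN A). assert (NB := HN B).
  assert (NA3 := HN (partial ax3 A)). assert (NB3 := HN (partial ax3 B)).
  destruct (filter_and _ _ (HV p0 Hp0)
    (filter_and _ _ (locally_bounded _ _ (C _ (Ck_S _ _ _ CA)))
    (filter_and _ _ (locally_bounded _ _ (C _ (Ck_S _ _ _ CB)))
    (filter_and _ _ (locally_bounded _ _ (C0 _ CA)) (locally_bounded _ _ (C0 _ CB))))))
    as [r0 Hr0].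
  set (r := Rmin r0 1).
  assert (Hr : 0 < r <= 1).
  { unfold r. split; [apply Rmin_glb_lt; [apply cond_pos|lra]|apply Rmin_r]. }
  assert (Hball : forall p, ball p0 r p -> ball p0 r0 p).
  { intros p. apply ball_le, Rmin_l. }
  assert (HM : 4 <= M) by (unfold M; lra).
  (* With [d * M = r / 16] and [4 <= M] the radius conditions hold; [r <= 1] takes care of the
     Lipschitz condition. *)
  set (d := r / (16 * M)).
  assert (HdM : d * M = r / 16) by (unfold d; field; lra).
  assert (Hd : 0 < d) by (apply Rdiv_lt_0_compat; lra).
  assert (Hdr : 4 * d <= r / 16) by (rewrite <- HdM; nra).
  assert (HVr : forall p, ball p0 r p -> V p).
  { intros p Hp. exact (proj1 (Hr0 p (Hball p Hp))). }
  destruct (ex_first_integral_of_bounds A B p0 r d M) as (u & K & H).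
  - exact (Ck_subset 2 V _ A HVr CA).
  - exact (Ck_subset 2 V _ B HVr CB).
  - intros p Hp. destruct (Hr0 p (Hball p Hp)) as (_ & E & _).
    unfold M. unfold N at 1. lra.
  - intros p Hp. destruct (Hr0 p (Hball p Hp)) as (_ & _ & E & _).
    unfold M. unfold N at 2. lra.
  - intros p Hp. destruct (Hr0 p (Hball p Hp)) as (_ & _ & _ & E & _).
    unfold M. unfold N at 3. lra.
  - intros p Hp. destruct (Hr0 p (Hball p Hp)) as (_ & _ & _ & _ & E).
    unfold M. unfold N at 4. lra.
  - exact Hd.
  - lra.
  - lra.
  - lra.
  - lra.
  - intros p Hp. apply Hint. now apply HVr.
  - exists (mkposreal d Hd), u, K. split; [|exact H].
    intros p Hp. apply HVr. apply (ball_le _ d); [lra|exact Hp].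
Qed.

(** * Calculus of C^k functions *)

Lemma Ck_const (n : nat) (V : R3 -> Prop) (c : R) : open V -> Ck n V (fun _ => c).
Proof.
  intros HV. revert c. induction n as [|n IH]; intros c.
  - split; [|exact I]. intros p _. cont.
  - apply (Ck_S_intro n V _ (fun _ _ => 0) HV); [intros p _; cont| |auto].
    intros i p _. apply is_derive_Rconst.
Qed.

Lemma Ck_plus (n : nat) (V : R3 -> Prop) (f g : R3 -> R) :
  open V -> Ck n V f -> Ck n V g -> Ck n V (fun p => f p + g p).
Proof.
  intros HV. revert f g. induction n as [|n IH]; intros f g Hf Hg.
  - split; [|exact I]. intros p Hp.
    assert (C1 := Ck_continuous _ _ _ p Hf Hp). assert (C2 := Ck_continuous _ _ _ p Hg Hp).
    cont.
  - apply (Ck_S_intro n V _ (fun i p => partial i f p + partial i g p) HV).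
    + intros p Hp.
      assert (C1 := Ck_continuous _ _ _ p Hf Hp). assert (C2 := Ck_continuous _ _ _ p Hg Hp).
      cont.
    + intros i p Hp. apply is_derive_Rplus; now apply (Ck_is_derive n V).
    + intros i. apply IH; now apply Ck_partial.
Qed.

Lemma Ck_mult (n : nat) (V : R3 -> Prop) (f g : R3 -> R) :
  open V -> Ck n V f -> Ck n V g -> Ck n V (fun p => f p * g p).
Proof.
  intros HV. revert f g. induction n as [|n IH]; intros f g Hf Hg.
  - split; [|exact I]. intros p Hp.
    assert (C1 := Ck_continuous _ _ _ p Hf Hp). assert (C2 := Ck_continuous _ _ _ p Hg Hp).
    cont.
  - apply (Ck_S_intro n V _ (fun i p => partial i f p * g p + f p * partial i g p) HV).
    + intros p Hp.
      assert (C1 := Ck_continuous _ _ _ p Hf Hp). assert (C2 := Ck_continuous _ _ _ p Hg Hp).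
      cont.
    + intros i p Hp. eapply is_derive_eq.
      * apply is_derive_Rmult; now apply (Ck_is_derive n V).
      * cbv beta. now rewrite set_coord_id.
    + intros i. apply Ck_plus; [exact HV| |]; apply IH;
        first [now apply Ck_partial | now apply Ck_S].
Qed.

Lemma is_derive_Rinv (f : R -> R) (t df : R) :
  is_derive f t df -> f t <> 0 -> is_derive (fun s => / f s) t (- df * (/ f t * / f t)).
Proof.
  intros Hf H0. eapply is_derive_eq; [exact (is_derive_inv f t df Hf H0)|].
  cbv beta. now field.
Qed.

Lemma Ck_inv (n : nat) (V : R3 -> Prop) (f : R3 -> R) :
  open V -> (forall p, V p -> f p <> 0) -> Ck n V f -> Ck n V (fun p => / f p).
Proof.
  intros HV H0. induction n as [|n IH]; intros Hf.
  - split; [|exact I]. intros p Hp. apply continuous_Rinv_fun; [|auto].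
    exact (Ck_continuous _ _ _ p Hf Hp).
  - assert (HI := IH (Ck_S _ _ _ Hf)).
    (* The derivative is written as a product so that [Ck_mult] applies, the factors [/ f p] being
       C^n by induction. *)
    apply (Ck_S_intro n V _ (fun i p => -1 * partial i f p * (/ f p * / f p)) HV).
    + intros p Hp. apply continuous_Rinv_fun; [|auto].
      exact (Ck_continuous _ _ _ p Hf Hp).
    + intros i p Hp. eapply is_derive_eq.
      * apply is_derive_Rinv; [now apply (Ck_is_derive n V)|].
        rewrite set_coord_id. auto.
      * cbv beta. rewrite set_coord_id. ring.
    + intros i. apply Ck_mult; [exact HV| |now apply Ck_mult].
      apply Ck_mult; [exact HV|now apply Ck_const|now apply Ck_partial].
Qed.

Lemma partial_mult (V : R3 -> Prop) (f g : R3 -> R) (i : axis) (p : R3) :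
  Ck 1 V f -> Ck 1 V g -> V p ->
  partial i (fun q => f q * g q) p = partial i f p * g p + f p * partial i g p.
Proof.
  intros Hf Hg Hp. apply is_derive_unique. eapply is_derive_eq.
  - apply is_derive_Rmult; now apply (Ck_is_derive 0 V).
  - cbv beta. now rewrite set_coord_id.
Qed.

Lemma partial_quotient (V : R3 -> Prop) (c : R) (f g : R3 -> R) (i : axis) (p : R3) :
  Ck 1 V f -> Ck 1 V g -> V p -> g p <> 0 ->
  partial i (fun q => c * f q * / g q) p =
    c * (partial i f p * g p - f p * partial i g p) / (g p * g p).
Proof.
  intros Hf Hg Hp H0. apply is_derive_unique. eapply is_derive_eq.
  - apply is_derive_Rmult; [apply is_derive_Rmult; [apply is_derive_Rconst|]|].
    + now apply (Ck_is_derive 0 V).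
    + apply is_derive_Rinv; [now apply (Ck_is_derive 0 V)|].
      now rewrite set_coord_id.
  - cbv beta. rewrite set_coord_id. now field.
Qed.

(** Schwarz's theorem on the plane [q] through [p] spanned by the two axes. As [i <> k], the order
    in which the two coordinates are set is immaterial, and both partial derivatives become
    derivatives within the plane. *)
Lemma partial_comm (V : R3 -> Prop) (u : R3 -> R) (i k : axis) (p : R3) :
  open V -> Ck 2 V u -> V p -> i <> k ->
  partial i (partial k u) p = partial k (partial i u) p.
Proof.
  intros HV Hu Hp Hik.
  set (q := fun a b => set_coord k (set_coord i p a) b).
  assert (Hq : q (coord i p) (coord k p) = p).
  { unfold q. now rewrite set_coord_id, set_coord_id. }
  assert (Cq : forall z : R * R, continuous (fun z => q (fst z) (snd z)) z).
  { intros z. unfold q. apply continuous_set_coord; [|cont].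
    apply continuous_set_coord; cont. }
  assert (Hi : forall f a b, partial i f (q a b) = Derive (fun t => f (q t b)) a).
  { intros f a b. destruct i, k; try easy; reflexivity. }
  assert (Hk : forall f a b, partial k f (q a b) = Derive (fun t => f (q a t)) b).
  { intros f a b. destruct i, k; try easy; reflexivity. }
  assert (Di : forall f a b, Ck 1 V f -> V (q a b) -> ex_derive (fun t => f (q t b)) a).
  { intros f a b Hf Hab. assert (D := proj1 (proj2 Hf i) _ Hab).
    destruct i, k; try easy; exact D. }
  assert (Dk : forall f a b, Ck 1 V f -> V (q a b) -> ex_derive (fun t => f (q a t)) b).
  { intros f a b Hf Hab. assert (D := proj1 (proj2 Hf k) _ Hab).
    destruct i, k; try easy; exact D. }
  assert (Cc : forall f, Ck 0 V f -> continuity_2d_pt (fun a b => f (q a b)) (coord i p) (coord k p)).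
  { intros f Hf. apply continuity_2d_pt_filterlim.
    apply (continuous_comp (fun z : R * R => q (fst z) (snd z)) f); [apply Cq|].
    apply (Ck_continuous 0 V f); [exact Hf|]. cbn [fst snd]. now rewrite Hq. }
  assert (Eik : (fun a b => partial i (partial k u) (q a b)) =
    (fun a b => Derive (fun z => Derive (fun t => u (q z t)) b) a)).
  { do 2 (apply functional_extensionality; intros ?). rewrite Hi.
    apply Derive_ext. intros z. apply Hk. }
  assert (Eki : (fun a b => partial k (partial i u) (q a b)) =
    (fun a b => Derive (fun z => Derive (fun t => u (q t z)) a) b)).
  { do 2 (apply functional_extensionality; intros ?). rewrite Hk.
    apply Derive_ext. intros z. apply Hi. }
  assert (S := Schwarz (fun a b => u (q a b)) (coord i p) (coord k p)).
  cut (partial i (partial k u) (q (coord i p) (coord k p)) =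
       partial k (partial i u) (q (coord i p) (coord k p))); [now rewrite Hq|].
  rewrite Hi, Hk.
  rewrite (Derive_ext _ (fun z => Derive (fun t => u (q z t)) (coord k p)))
    by (intros t; apply Hk).
  rewrite (Derive_ext (fun t => partial i u (q (coord i p) t))
    (fun z => Derive (fun t => u (q t z)) (coord i p)))
    by (intros t; apply Hi).
  apply S.
  - apply locally_2d_locally.
    assert (L : locally (coord i p, coord k p) (fun z : R * R => V (q (fst z) (snd z)))).
    { apply (Cq (coord i p, coord k p) V). cbn [fst snd]. rewrite Hq. now apply HV. }
    revert L. apply filter_imp. intros [a b] Hab; cbn [fst snd] in *.
    split; [|split; [|split]].
    + apply Di; [now apply Ck_S|exact Hab].
    + apply Dk; [now apply Ck_S|exact Hab].
    + apply (ex_derive_ext (fun z => partial k u (q z b))); [intros t; apply Hk|].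
      apply Di; [now apply Ck_partial|exact Hab].
    + apply (ex_derive_ext (fun z => partial i u (q a z))); [intros t; apply Hi|].
      apply Dk; [now apply Ck_partial|exact Hab].
  - rewrite <- Eik. apply Cc. now apply Ck_partial, Ck_partial.
  - rewrite <- Eki. apply Cc. now apply Ck_partial, Ck_partial.
Qed.

(** * Realizability *)

(** The condition at one point, because the nonzero component of [j], and with it the rotation,
    depends on the point. *)
Definition realizable_at (j : R3 -> R3) (x : R3) : Prop :=
  exists V : R3 -> Prop,
    open V /\ V x /\
    exists (sigma u : R3 -> R),
      (forall p, V p -> 0 < sigma p) /\ Ck 1 V sigma /\ Ck 1 V u /\
      (forall p, V p -> j p = scal (sigma p) (grad u p)).

Lemma coord_scal_grad (s : R) (u : R3 -> R) (p : R3) (i : axis) :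
  coord i (scal s (grad u p)) = s * partial i u p.
Proof. now destruct i. Qed.

Lemma dot_curl (j : R3 -> R3) (p : R3) :
  let d i k := partial i (fun q => coord k (j q)) p in
  dot (j p) (curl j p) =
    coord ax1 (j p) * (d ax2 ax3 - d ax3 ax2) +
    coord ax2 (j p) * (d ax3 ax1 - d ax1 ax3) +
    coord ax3 (j p) * (d ax1 ax2 - d ax2 ax1).
Proof. reflexivity. Qed.

Lemma realizable_dot_curl (j : R3 -> R3) (x : R3) :
  Ck_field 2 whole_space j -> realizable_at j x -> dot (j x) (curl j x) = 0.
Proof.
  intros Hj (V & HV & Hx & sigma & u & Hpos & Cs & Cu & Hju).
  assert (Hcoord : forall i p, V p -> coord i (j p) = sigma p * partial i u p).
  { intros i p Hp. rewrite (Hju p Hp). apply coord_scal_grad. }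
  assert (Cj : forall i, Ck 1 V (fun p => coord i (j p))).
  { intros i. apply (Ck_subset 1 whole_space); [easy|]. apply Ck_S, Hj. }
  (* Each partial derivative of [u] is the quotient of a component of [j] by [sigma], both C^1. *)
  assert (Cdu : forall i, Ck 1 V (partial i u)).
  { intros i. apply (Ck_ext 1 V (fun p => coord i (j p) * / sigma p)); [exact HV| |].
    - intros p Hp. rewrite Hcoord by assumption. field.
      apply Rgt_not_eq. now apply Hpos.
    - apply Ck_mult; [exact HV|apply Cj|]. apply Ck_inv; [exact HV| |exact Cs].
      intros p Hp. apply Rgt_not_eq. now apply Hpos. }
  assert (C2u : Ck 2 V u).
  { destruct Cu as [H1 H2]. split; [exact H1|]. intros i.
    split; [exact (proj1 (H2 i))|apply Cdu]. }
  assert (Hd : forall i k, partial i (fun p => coord k (j p)) x =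
            partial i sigma x * partial k u x + sigma x * partial i (partial k u) x).
  { intros i k. rewrite (partial_ext V _ (fun p => sigma p * partial k u p) i x HV); auto.
    exact (partial_mult V sigma (partial k u) i x Cs (Cdu k) Hx). }
  rewrite dot_curl. cbv zeta. rewrite !Hd.
  rewrite !Hcoord by assumption.
  (* Once the second derivatives of [u] cancel in pairs, a triple product with [grad u] occurring
     twice remains. *)
  rewrite (partial_comm V u ax2 ax1 x), (partial_comm V u ax3 ax1 x),
    (partial_comm V u ax3 ax2 x) by easy.
  ring.
Qed.

Lemma realizable_of_coord3 (j : R3 -> R3) (x : R3) :
  Ck_field 2 whole_space j -> (forall p, dot (j p) (curl j p) = 0) ->
  coord ax3 (j x) <> 0 -> realizable_at j x.
Proof.
  intros Hj Hc Hx.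
  (* The sign of [j_3] at [x]. It multiplies both the conductivity, to make it positive, and the
     potential, so that it cancels in their product by [e * e = 1]. *)
  set (e := if Rlt_dec 0 (coord ax3 (j x)) then 1 else -1).
  assert (He : e * e = 1) by (unfold e; destruct Rlt_dec; ring).
  assert (Hex : 0 < e * coord ax3 (j x)) by (unfold e; destruct Rlt_dec; lra).
  set (V := fun p => 0 < e * coord ax3 (j p)).
  assert (Cc : forall i p, continuous (fun q => coord i (j q)) p).
  { intros i p. exact (Ck_continuous 2 _ _ p (Hj i) I). }
  assert (HV : open V).
  { intros p Hp. assert (C : continuous (fun q => e * coord ax3 (j q)) p).
    { apply continuous_Rmult; [cont|apply Cc]. }
    exact (C _ (open_gt 0 _ Hp)). }
  assert (H0 : forall p, V p -> coord ax3 (j p) <> 0).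
  { intros p Hp H. unfold V in Hp. rewrite H in Hp. lra. }
  assert (Cj : forall i, Ck 2 V (fun p => coord i (j p))).
  { intros i. apply (Ck_subset 2 whole_space); [easy|apply Hj]. }
  set (slope := fun i p => -1 * coord i (j p) * / coord ax3 (j p)).
  assert (Cs : forall i, Ck 2 V (slope i)).
  { intros i. apply Ck_mult; [exact HV| |now apply Ck_inv].
    apply Ck_mult; [exact HV|now apply Ck_const|apply Cj]. }
  destruct (ex_first_integral (slope ax1) (slope ax2) x V HV Hex (Cs ax1) (Cs ax2))
    as (d & u & K & Hd & Cu & CK & HK & H1 & H2 & H3).
  { intros p Hp. unfold slope. specialize (H0 p Hp). specialize (Hc p).
    rewrite !(partial_quotient V) by (auto; apply Ck_S, Cj).
    (* For these slopes the defect of integrability is exactly [j . curl j] divided by the square of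
       [j_3]. *)
    apply Rminus_diag_uniq.
    transitivity (dot (j p) (curl j p) / (coord ax3 (j p) * coord ax3 (j p)));
      [|rewrite Hc; field; exact H0].
    rewrite dot_curl. cbv zeta. field. exact H0. }
  assert (HD := open_ball_R3 x d).
  exists (ball x d). split; [exact HD|split; [apply ball_center|]].
  exists (fun p => e * coord ax3 (j p) * / K p), (fun p => e * u p).
  assert (HK0 : forall p, ball x d p -> K p <> 0).
  { intros p Hp. apply Rgt_not_eq. now apply HK. }
  split; [|split; [|split]].
  - intros p Hp. apply Rmult_lt_0_compat; [exact (Hd p Hp)|].
    apply Rinv_0_lt_compat. now apply HK.
  - apply Ck_mult; [exact HD| |now apply Ck_inv].
    apply Ck_mult; [exact HD|now apply Ck_const|].
    exact (Ck_subset 1 V _ _ Hd (Ck_S _ _ _ (Cj ax3))).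
  - apply Ck_mult; [exact HD|now apply Ck_const|exact Cu].
  - intros p Hp. specialize (H0 p (Hd p Hp)). specialize (HK0 p Hp).
    assert (Hu : forall i, partial i (fun p => e * u p) p = e * partial i u p).
    { intros i. rewrite (partial_mult (ball x d) (fun _ => e) u i p).
      - assert (E : partial i (fun _ => e) p = 0) by exact (Derive_const e (coord i p)).
        rewrite E. ring.
      - now apply Ck_const.
      - exact Cu.
      - exact Hp. }
    assert (Hj' : forall i, coord i (j p) =
      coord i (scal (e * coord ax3 (j p) * / K p) (grad (fun p => e * u p) p))).
    { intros i. rewrite coord_scal_grad, Hu.
      transitivity (e * e * (coord ax3 (j p) * / K p * partial i u p)); [|ring].
      rewrite He. destruct i; [rewrite (H1 p Hp)|rewrite (H2 p Hp)|rewrite (H3 p Hp)];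
        unfold slope; cbn [coord] in *; field; auto. }
    assert (E1 := Hj' ax1). assert (E2 := Hj' ax2). assert (E3 := Hj' ax3).
    destruct (j p) as [[j1 j2] j3], (scal _ _) as [[k1 k2] k3]. simpl in *. congruence.
Qed.

(** * Cyclic permutation of the coordinates *)

Definition rot (p : R3) : R3 := (coord ax2 p, coord ax3 p, coord ax1 p).

Definition next (i : axis) : axis :=
  match i with ax1 => ax2 | ax2 => ax3 | ax3 => ax1 end.

Lemma continuous_rot (p : R3) : continuous rot p.
Proof. unfold rot, coord. cont. Qed.

Lemma partial_comp_rot (f : R3 -> R) (i : axis) :
  partial (next i) (fun p => f (rot p)) = (fun p => partial i f (rot p)).
Proof. now destruct i. Qed.

Lemma Ck_comp_rot (n : nat) (V : R3 -> Prop) (f : R3 -> R) :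
  Ck n V f -> Ck n (fun p => V (rot p)) (fun p => f (rot p)).
Proof.
  revert f. induction n as [|n IH]; intros f Hf.
  - split; [|exact I]. intros p Hp. apply (continuous_comp rot f); [apply continuous_rot|].
    exact (Ck_continuous 0 V f _ Hf Hp).
  - split.
    + intros p Hp. apply (continuous_comp rot f); [apply continuous_rot|].
      exact (Ck_continuous _ V f _ Hf Hp).
    + assert (H : forall i,
        (forall p, V (rot p) -> ex_partial (next i) (fun p => f (rot p)) p) /\
        Ck n (fun p => V (rot p)) (partial (next i) (fun p => f (rot p)))).
      { intros i. destruct Hf as [_ Hf]. destruct (Hf i) as [H1 H2]. split.
        - intros p Hp. assert (H := H1 _ Hp). destruct i; exact H.
        - rewrite partial_comp_rot. exact (IH _ H2). }
      intros []; [exact (H ax3)|exact (H ax1)|exact (H ax2)].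
Qed.

(** The push-forward of [j] by [rot]: since [rot] has order 3, [rot (rot q)] is the preimage of
    [q]. *)
Definition rot_field (j : R3 -> R3) (q : R3) : R3 := rot (j (rot (rot q))).

Lemma rot_cube (p : R3) : rot (rot (rot p)) = p.
Proof. now destruct p as [[x y] z]. Qed.

Lemma Ck_rot_field (n : nat) (j : R3 -> R3) :
  Ck_field n whole_space j -> Ck_field n whole_space (rot_field j).
Proof.
  intros Hj i.
  assert (H := Ck_comp_rot n _ _ (Ck_comp_rot n _ _ (Hj (next i)))).
  destruct i; exact H.
Qed.

(** A cyclic permutation preserves orientation, so the curl is transported without a change of sign
    and the three terms are merely permuted. *)
Lemma dot_curl_rot_field (j : R3 -> R3) (q : R3) :
  dot (rot_field j q) (curl (rot_field j) q) =
  dot (j (rot (rot q))) (curl j (rot (rot q))).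
Proof.
  assert (E : forall i k, partial i (fun q => coord k (rot_field j q)) q =
    partial (next i) (fun p => coord (next k) (j p)) (rot (rot q))).
  { intros [] []; reflexivity. }
  rewrite !dot_curl. cbv zeta.
  rewrite (E ax2 ax3), (E ax3 ax2), (E ax3 ax1), (E ax1 ax3), (E ax1 ax2), (E ax2 ax1).
  cbn [next].
  change (coord ax1 (rot_field j q)) with (coord ax2 (j (rot (rot q)))).
  change (coord ax2 (rot_field j q)) with (coord ax3 (j (rot (rot q)))).
  change (coord ax3 (rot_field j q)) with (coord ax1 (j (rot (rot q)))).
  ring.
Qed.

Lemma realizable_of_rot_field (j : R3 -> R3) (x : R3) :
  realizable_at (rot_field j) (rot x) -> realizable_at j x.
Proof.
  intros (V & HV & Hx & sigma & u & Hpos & Cs & Cu & Hju).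
  exists (fun p => V (rot p)). split; [|split; [exact Hx|]].
  { intros p Hp. exact (continuous_rot p _ (HV _ Hp)). }
  exists (fun p => sigma (rot p)), (fun p => u (rot p)).
  split; [intros p Hp; now apply Hpos|].
  split; [now apply Ck_comp_rot|split; [now apply Ck_comp_rot|]].
  intros p Hp. assert (H := Hju (rot p) Hp). unfold rot_field in H.
  rewrite rot_cube in H.
  apply (f_equal (fun q => rot (rot q))) in H. rewrite rot_cube in H.
  rewrite H. reflexivity.
Qed.

Theorem proposition2p2 (j : R3 -> R3)
  (j_C2 : Ck_field 2 whole_space j)
  (j_neq0 : forall p : R3, j p <> (0, 0, 0))
  (j_div0 : forall p : R3, div j p = 0) :
  locally_isotropically_realizable j <->
  (forall p : R3, dot (j p) (curl j p) = 0).
Proof.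
  split.
  - intros H p. apply realizable_dot_curl; [exact j_C2|exact (H p)].
  - intros H x.
    assert (H1 : forall q, dot (rot_field j q) (curl (rot_field j) q) = 0).
    { intros q. rewrite dot_curl_rot_field. apply H. }
    assert (C1 := Ck_rot_field 2 j j_C2).
    (* One rotation brings the first component of [j x] to the third place, two rotations bring the
       second. *)
    destruct (Req_dec (coord ax3 (j x)) 0) as [E3|N3];
      [|exact (realizable_of_coord3 j x j_C2 H N3)].
    apply realizable_of_rot_field.
    destruct (Req_dec (coord ax1 (j x)) 0) as [E1|N1].
    + apply realizable_of_rot_field, realizable_of_coord3.
      * now apply Ck_rot_field.
      * intros q. rewrite dot_curl_rot_field. apply H1.
      * unfold rot_field. rewrite !rot_cube. intros E2. apply (j_neq0 x).
        destruct (j x) as [[a b] c]. simpl in *. congruence.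
    + apply realizable_of_coord3; [exact C1|exact H1|].
      unfold rot_field. now rewrite rot_cube.
Qed.
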